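(* Let $\Omega$ be a set with exactly three elements, $m\in\Delta(\Omega)$, $\lambda\in[0,1)$, and consider the irreducible Markov chain on $\Omega$ with transitions $\pi(\omega\mid\omega)=(1-\lambda)m(\omega)+\lambda$ and $\pi(\omega'\mid\omega)=(1-\lambda)m(\omega')$ for $\omega'\ne\omega$ (so $\phi(p)=m+\lambda(p-m)$). Let $r:\Omega\to\mathbb{R}$ and $\delta\in[0,1)$. Then the greedy strategy $\sigma_*$ is optimal at every initial belief $p_1\in\Delta(\Omega)$ in each of the following cases: (i) $|\Omega^-|=1$; (ii) $|\Omega^-|=2$, writing $\Omega^+=\{A\}$ and $\Omega^-=\{B,C\}$ with $r(B)\ge r(C)$, and letting $B^+$ (resp. $C^+$) be the unique point of $\mathcal{F}$ on the segment $[A,B]$ (resp. $[A,C]$), the invariant distribution $m$ belongs either to $I$ or to the triangle with vertices $C^+,B^+,C$.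
   Context: Identify each $\omega\in\Omega$ with a unit vector of $\mathbb{R}^\Omega$ and $\Delta(\Omega)$ with the unit simplex. For $p\in\Delta(\Omega)$ let $\langle p,r\rangle=\sum_\omega p(\omega)r(\omega)$; $I=\{p:\langle p,r\rangle\ge0\}$, $J=\Delta(\Omega)\setminus I$, $\mathcal{F}=\{p:\langle p,r\rangle=0\}$; $\Omega^+=\{\omega:r(\omega)\ge0\}$, $\Omega^-=\{\omega:r(\omega)<0\}$. $\phi(q)=qM$ with $M$ the transition matrix. $\mathcal{S}(p)$ is the set of Borel probability measures on $\Delta(\Omega)$ with mean $p$, $\mu_p$ the Dirac mass at $p$. Decision problem from $p_1$: at each stage $n$, at belief $p_n$, the advisor chooses $\mu\in\mathcal{S}(p_n)$ (possibly depending on the past), a posterior $q_n\sim\mu$ is drawn, the stage payoff is $\mathbf{1}_{\{q_n\in I\}}$, and $p_{n+1}=\phi(q_n)$. A strategy's payoff is $\mathbb{E}[(1-\delta)\sum_{n\ge1}\delta^{n-1}\mathbf{1}_{\{q_n\in I\}}]$; $V_\delta(p_1)$ is the maximal payoff; a strategy is optimal at $p_1$ if it achieves $V_\delta(p_1)$. The greedy strategy $\sigma_*$: at $p\in I$ choose $\mu_p$; at $p\in J$ choose a two-point splitting $p=a_Iq_I+a_Jq_J$ (posterior $q_I$ w.p. $a_I$, $q_J$ w.p. $a_J$) maximizing $a_I$ subject to $q_I\in I$, $q_J\in\Delta(\Omega)$, $a_I+a_J=1$, $a_I,a_J\ge0$. *)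

(* Defs.v *)
From HB Require Import structures.
From mathcomp Require Import all_boot all_order all_algebra.
From mathcomp Require Import all_classical all_reals all_analysis.
Set Implicit Arguments. Unset Strict Implicit. Unset Printing Implicit Defensive.
Import Order.TTheory GRing.Theory Num.Theory.
Local Open Scope classical_set_scope.
Local Open Scope ring_scope.

(* The state space Omega is 'I_3.  A belief (element of R^Omega) is
   represented as a point of the measurable space R * R * R (Borel product
   sigma-algebra), coordinates indexed by 'I_3. *)
Definition belief (R : realType) := (R * R * R)%type.

Definition coord (R : realType) (p : belief R) (i : 'I_3) : R :=
  match val i with 0 => p.1.1 | 1 => p.1.2 | _ => p.2 end.

Definition mkbelief (R : realType) (f : 'I_3 -> R) : belief R :=
  (f (inord 0), f (inord 1), f (inord 2)).

Definition vertex (R : realType) (w : 'I_3) : belief R :=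
  mkbelief (fun i => if i == w then 1 else 0).

Definition inSimplex (R : realType) (p : belief R) : Prop :=
  (forall i, 0 <= coord p i) /\ \sum_(i < 3) coord p i = 1.

Definition inner (R : realType) (p : belief R) (r : 'I_3 -> R) : R :=
  \sum_(i < 3) coord p i * r i.

Definition inI (R : realType) (r : 'I_3 -> R) (p : belief R) : Prop :=
  inSimplex p /\ 0 <= inner p r.

Definition inF (R : realType) (r : 'I_3 -> R) (p : belief R) : Prop :=
  inSimplex p /\ inner p r = 0.

Definition trans (R : realType) (lam : R) (m : belief R) : 'M[R]_3 :=
  \matrix_(i < 3, j < 3) ((1 - lam) * coord m j + (if i == j then lam else 0)).

Definition irreducible (R : realType) (M : 'M[R]_3) : Prop :=
  forall i j : 'I_3, exists n : nat, 0 < (M ^+ n) i j.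

Definition phi (R : realType) (M : 'M[R]_3) (q : belief R) : belief R :=
  mkbelief (fun j => \sum_(i < 3) coord q i * M i j).

Definition in_segment (R : realType) (x a b : belief R) : Prop :=
  exists t : R, 0 <= t <= 1 /\
    forall i, coord x i = t * coord a i + (1 - t) * coord b i.

Definition in_triangle (R : realType) (x a b c : belief R) : Prop :=
  exists s t u : R, [/\ 0 <= s, 0 <= t, 0 <= u, s + t + u = 1 &
    forall i, coord x i = s * coord a i + t * coord b i + u * coord c i].

Definition splitting (R : realType) (mu : probability (belief R) R)
    (p : belief R) : Prop :=
  mu [set q | inSimplex q] = 1%E /\
  forall i, (\int[mu]_q (coord q i)%:E)%E = (coord p i)%:E.

Definition feasible_split (R : realType) (r : 'I_3 -> R) (p : belief R)
    (aI aJ : R) (qI qJ : belief R) : Prop :=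
  [/\ [/\ 0 <= aI, 0 <= aJ & aI + aJ = 1], inI r qI, inSimplex qJ &
      forall i, coord p i = aI * coord qI i + aJ * coord qJ i].

Definition greedy_choice (R : realType) (r : 'I_3 -> R)
    (mu : probability (belief R) R) (p : belief R) : Prop :=
  (inI r p -> forall A, measurable A -> mu A = \d_p A) /\
  (~ inI r p -> exists (aI aJ : R) (qI qJ : belief R),
     [/\ feasible_split r p aI aJ qI qJ,
         (forall aI' aJ' qI' qJ', feasible_split r p aI' aJ' qI' qJ' -> aI' <= aI) &
         forall A, measurable A ->
           mu A = (aI%:E * \d_qI A + aJ%:E * \d_qJ A)%E]).

(* A strategy maps the history of past posteriors (q_1,...,q_{n-1}) to the
   splitting chosen at stage n. *)
Definition strategy (R : realType) := seq (belief R) -> probability (belief R) R.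

Definition cur_belief (R : realType) (M : 'M[R]_3) (p1 : belief R)
    (h : seq (belief R)) : belief R :=
  last p1 (map (phi M) h).

Definition admissible (R : realType) (M : 'M[R]_3) (p1 : belief R)
    (s : strategy R) : Prop :=
  forall h : seq (belief R), all (fun q => `[< inSimplex q >]) h ->
    splitting (s h) (cur_belief M p1 h).

(* expected discounted payoff of the first N stages following history h:
   E[ sum_{k<N} (1-delta) delta^k 1_I(q_{n+k}) ] *)
Fixpoint payoffN (R : realType) (r : 'I_3 -> R) (delta : R) (s : strategy R)
    (N : nat) (h : seq (belief R)) : \bar R :=
  match N with
  | 0 => 0%E
  | N'.+1 => (\int[s h]_q
       (((1 - delta) * \1_[set x | inI r x] q)%:E
        + delta%:E * payoffN r delta s N' (rcons h q)))%E
  end.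

(* the payoff E[(1-delta) sum_n delta^(n-1) 1_I(q_n)] as the (monotone)
   limit of the finite-horizon payoffs *)
Definition payoff (R : realType) (r : 'I_3 -> R) (delta : R)
    (s : strategy R) : \bar R :=
  ereal_sup [set payoffN r delta s N [::] | N in [set: nat]].

Definition value (R : realType) (r : 'I_3 -> R) (delta : R) (M : 'M[R]_3)
    (p1 : belief R) : \bar R :=
  ereal_sup [set payoff r delta s | s in [set s | admissible M p1 s]].

Definition optimal_at (R : realType) (r : 'I_3 -> R) (delta : R)
    (M : 'M[R]_3) (p1 : belief R) (s : strategy R) : Prop :=
  admissible M p1 s /\ payoff r delta s = value r delta M p1.

Definition greedy_selector (R : realType) (r : 'I_3 -> R)
    (g : belief R -> probability (belief R) R) : Prop :=
  forall p, inSimplex p -> greedy_choice r (g p) p.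

Definition greedy_strategy (R : realType) (M : 'M[R]_3) (p1 : belief R)
    (g : belief R -> probability (belief R) R) : strategy R :=
  fun h => g (cur_belief M p1 h).

(* Main.v *)
Require Import Defs.
From HB Require Import structures.
From mathcomp Require Import all_boot all_order all_algebra.
From mathcomp Require Import all_classical all_reals all_analysis.
From mathcomp Require Import measurable_realfun ring lra.
Set Implicit Arguments. Unset Strict Implicit. Unset Printing Implicit Defensive.
Import Order.TTheory GRing.Theory Num.Theory.
Local Open Scope classical_set_scope.
Local Open Scope ring_scope.

(** Measure a belief by two linear functionals [E] and [Z] that send [B+], [B], [C]
    to (0,0), (1,0), (0,1), and [A] to a point of the negative [E]-axis.  Then
    I = {Z + eta E <= 0} with 0 < eta <= 1, the greedy rule puts mass
    Z + max(E, eta E) on the rejected posterior, and the hypothesis on [m] gives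
    E(m) <= 0.  When all losses are equal (in particular in case (i)) one can
    arrange E <= 0 on the whole simplex.

    The n-stage greedy payoff [W n] is an explicit recursive function of (E, Z).
    If m is in I, it is a constant minus a loss that vanishes on I, is
    proportional to Z + eta E where E <= 0, and is homogeneous about [B+] where
    E > 0.  Otherwise it is the sum of the discounted concavifications of the
    indicator of I along the expected beliefs, minus such a loss supported on
    {E > 0}.  In both cases the loss has at each point a supporting linear
    functional [b E + g Z], and homogeneity turns a functional supporting the
    n-stage loss into one supporting the (n+1)-stage loss.  The inequality
    [1 + delta * drift b g >= 0] propagates along and yields that not splitting
    (payoff [delta * W n (phi p)]) is never better than the greedy split.  Hence
    [W n.+1] has at each belief an affine majorant of
    [1_I + delta * W n \o phi] which is exact there, and integrating it against
    any splitting bounds the payoff of any strategy.  Integrands may fail to be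
    measurable, but they are nonnegative, and the integral, a supremum over
    simple functions, is monotone without measurability. *)

(* [vector.coord] shadows the coordinate function of beliefs. *)
Local Notation coord := Defs.coord.

(** * Supporting functionals of the greedy value in the plane *)

Section ScalarRecursions.
Context (R : realFieldType) (delta lam eta Em Zm : R).
Hypotheses (delta_ge0 : 0 <= delta) (delta_le1 : delta <= 1).
Hypotheses (lam_ge0 : 0 <= lam) (lam_le1 : lam <= 1).
Hypotheses (eta_gt0 : 0 < eta) (eta_le1 : eta <= 1).
Hypotheses (Em_le0 : Em <= 0) (Zm_ge0 : 0 <= Zm) (Zm_le1 : Zm <= 1).

Definition mix (k x : R) := (1 - lam) * k + lam * x.

Lemma mix_ge0 (k x : R) : 0 <= k -> 0 <= x -> 0 <= mix k x.
Proof. by move=> k0 x0; rewrite /mix addr_ge0 ?mulr_ge0 ?subr_ge0. Qed.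

Lemma mix_le (k x y : R) : k <= y -> x <= y -> mix k x <= y.
Proof.
move=> ky xy; rewrite /mix.
have : (1 - lam) * k <= (1 - lam) * y by rewrite ler_wpM2l // subr_ge0.
have := ler_wpM2l lam_ge0 xy; lra.
Qed.

Lemma simplex_normalize (e z : R) : 0 < e -> 0 <= z ->
  exists s x : R, [/\ e / (e + z) = x, z / (e + z) = 1 - x, e = s * x,
                  z = s * (1 - x) & [/\ 0 < s, s = e + z, 0 < x & x <= 1]].
Proof.
move=> e0 z0; have s0 : 0 < e + z by lra.
exists (e + z), (e / (e + z)); split => //.
- by field; rewrite lt0r_neq0.
- by field; rewrite lt0r_neq0.
- by field; rewrite lt0r_neq0.
- split => //; first by rewrite divr_gt0.
  by rewrite ler_pdivrMr //; lra.
Qed.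

(* With [x = 1 - Z - eta * E], [Num.min 1 x] is on {E <= 0} the concavification
   of the indicator of I. *)
Fixpoint concave_sum (n : nat) (x : R) : R :=
  if n is n'.+1
  then Num.min 1 x + delta * concave_sum n' (mix (1 - Zm - eta * Em) x)
  else 0.

(** Built from affine maps and [Num.min 1], [concave_sum] is concave; a supergradient is accumulated
    along the recursion. *)
Lemma concave_sum_support n (x0 : R) :
  exists s : R, forall x : R, concave_sum n x <= concave_sum n x0 + s * (x - x0).
Proof.
elim: n x0 => [|n IH] x0 /=.
  by exists 0 => x; rewrite mul0r addr0.
have [s Hs] := IH (mix (1 - Zm - eta * Em) x0).
have [t Ht] : exists t : R, forall x,
    Num.min 1 x <= Num.min 1 x0 + t * (x - x0).
  have [h|h] := leP x0 1.
    by exists 1 => x; rewrite ge_min; apply/orP; right; lra.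
  by exists 0 => x; rewrite mul0r addr0 ge_min lexx.
exists (t + delta * (lam * s)) => x.
have h1 := Ht x; have h2 := ler_wpM2l delta_ge0 (Hs (mix (1 - Zm - eta * Em) x)).
move: h1 h2; rewrite /mix; lra.
Qed.

(** The hypothesis makes [mix] preserve [0,1], so the recursion never crosses the kink of
    [Num.min 1]. *)
Lemma concave_sum_affine n : 0 <= 1 - Zm - eta * Em <= 1 ->
  exists u v : R, forall x : R, 0 <= x <= 1 -> concave_sum n x = u + v * x.
Proof.
move=> /andP[hm0 hm1]; elim: n => [|n [u [v IH]]] /=.
  by exists 0, 0 => x _; rewrite mul0r addr0.
exists (delta * (u + v * ((1 - lam) * (1 - Zm - eta * Em)))), (1 + delta * (v * lam)).
move=> x /andP[x0 x1].
rewrite (min_r x1) IH; first by rewrite /mix; ring.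
by rewrite mix_ge0 // mix_le.
Qed.

(* On {e > 0} the accepted posterior is [B+], i.e. (0, 0), so the rejected one is
   the central projection of (e, z) from [B+] to the edge [B, C]. *)
Fixpoint residual_loss (n : nat) (e z : R) : R :=
  if n is n'.+1 then
    if e <= 0 then 0
    else (1 - eta) * e + delta * ((e + z) *
         residual_loss n' (mix Em (e / (e + z))) (mix Zm (z / (e + z))))
  else 0.

Lemma residual_loss_ge0 n (e z : R) : 0 <= z -> 0 <= residual_loss n e z.
Proof.
elim: n e z => //= n IH e z z0; have [//|e0] := leP e 0.
have s0 : 0 < e + z by lra.
rewrite addr_ge0 // mulr_ge0 ?subr_ge0 // ?(ltW e0) // mulr_ge0 ?(ltW s0) //.
by apply: IH; rewrite mix_ge0 // divr_ge0 // ltW.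
Qed.

Lemma residual_loss_eq0 n (e z : R) : e <= 0 -> residual_loss n e z = 0.
Proof. by case: n => //= n ->. Qed.

(** The losses are homogeneous of degree one, so their supporting functionals carry no constant
    term. *)
Definition minorant (D : R -> R -> R) (b g : R) :=
  forall e z : R, 0 <= z -> b * e + g * z <= D e z.

(** The constant term of [b * e + g * z] evaluated after one transition; the remaining part is
    [lam * (b * e + g * z)]. *)
Definition drift (b g : R) := (1 - lam) * (b * Em + g * Zm).


(** The signs of [b] and [g] keep the functional nonpositive on {E <= 0}, where the loss vanishes.
    The quantity [mix (Em + Zm) 1] is the constant value of E + Z on the image of the edge
    [B, C]. *)
Lemma residual_loss_support n (e z : R) : 0 <= z ->
  exists b g : R, [/\ 0 <= b, g <= 0, b * e + g * z = residual_loss n e z,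
    minorant (residual_loss n) b g &
    0 <= mix (Em + Zm) 1 -> 0 <= 1 + delta * drift b g].
Proof.
elim: n e z => [|n IH] e z z0.
  exists 0, 0; split => //=; first by rewrite !mul0r addr0.
    by move=> e' z' _; rewrite !mul0r addr0.
  by rewrite /drift; lra.
have zero m : minorant (residual_loss m) 0 0.
  by move=> e' z' ?; rewrite !mul0r addr0 residual_loss_ge0.
have [e0|e0] := leP e 0.
  exists 0, 0; split => //; first by rewrite residual_loss_eq0 // !mul0r addr0.
  by rewrite /drift; lra.
have [s [y [ey zy es zs [s0 sE y0 y1]]]] := simplex_normalize e0 z0.
have z0' : 0 <= mix Zm (1 - y) by rewrite mix_ge0 // subr_ge0.
have [b [g [b0 g0 act mino good]]] := IH (mix Em y) _ z0'.
have act0 : 0 <= b * mix Em y + g * mix Zm (1 - y).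
  by rewrite act residual_loss_ge0.
have dr0 : drift b g <= 0.
  rewrite /drift mulr_ge0_le0 ?subr_ge0 //.
  by have := mulr_ge0_le0 b0 Em_le0; have := mulr_le0_ge0 g0 Zm_ge0; lra.
(* Multiplied by [e + z], the stage-[n] functional at the image of the projected point becomes
   linear in [e] and [z]: it is [lam * (b * e + g * z) + drift b g * (e + z)]. *)
pose b' := 1 - eta + delta * (lam * b + drift b g).
pose g' := delta * (lam * g + drift b g).
have b'0 : 0 <= b'.
  (* The right side is the functional at the image of B; as [g <= b], it dominates the value at the
     image of the projected point, which is nonnegative. *)
  suff h : b * mix Em y + g * mix Zm (1 - y) <= lam * b + drift b g.
    by rewrite addr_ge0 ?subr_ge0 // mulr_ge0 // (le_trans act0).
  suff : 0 <= lam * (1 - y) * (b - g) by rewrite /drift /mix; lra.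
  by rewrite !mulr_ge0 ?subr_ge0 // (le_trans g0).
have g'0 : g' <= 0.
  by rewrite mulr_ge0_le0 //; have := mulr_ge0_le0 lam_ge0 g0; lra.
exists b', g'; split => //.
- rewrite /= leNgt e0 /= ey zy -sE -act es zs.
  by rewrite /b' /g' /drift /mix; ring.
- move=> e' z' z'0 /=; have [e'0|e'0] := leP e' 0.
    by have := mulr_ge0_le0 b'0 e'0; have := mulr_le0_ge0 g'0 z'0; lra.
  have [t [x [ex zx et zt [t0 tE x0 x1]]]] := simplex_normalize e'0 z'0.
  rewrite ex zx -tE.
  have h : b * mix Em x + g * mix Zm (1 - x) <=
      residual_loss n (mix Em x) (mix Zm (1 - x)).
    by apply: mino; rewrite mix_ge0 ?subr_ge0.
  have := ler_wpM2l delta_ge0 (ler_wpM2l (ltW t0) h).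
  by rewrite et zt /b' /g' /drift /mix; lra.
- move=> j0.
  have -> : drift b' g' =
      (1 - lam) * ((1 - eta) * Em) + delta * drift b g * mix (Em + Zm) 1.
    by rewrite /b' /g' /drift /mix; ring.
  set X := (1 - lam) * _ + _.
  (* The inductive inequality times [mix (Em + Zm) 1] gives
     [X >= - lam - (1 - lam) * (Zm + eta * Em)], and [Zm + eta * Em <= 1]. *)
  suff hX : -1 <= X by move: (ler_wpM2l delta_ge0 hX) delta_le1; lra.
  have := mulr_ge0 (good j0) j0.
  have : (1 - lam) * (Zm + eta * Em) <= 1 - lam.
    rewrite -[leRHS]mulr1 ler_wpM2l ?subr_ge0 //.
    by move: (mulr_ge0_le0 (ltW eta_gt0) Em_le0) Zm_le1; lra.
  by rewrite /X /mix; lra.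
Qed.

(* Without [0 <= mix (Em + Zm) 1] the edge [B, C] is mapped outside {E > 0}. *)
Lemma residual_loss_edge_support n (x : R) : 0 <= x <= 1 ->
  exists b g : R, [/\ b * mix Em x + g * mix Zm (1 - x)
      = residual_loss n (mix Em x) (mix Zm (1 - x)),
    minorant (residual_loss n) b g & 0 <= 1 + delta * drift b g].
Proof.
move=> /andP[x0 x1].
have z0 : 0 <= mix Zm (1 - x) by rewrite mix_ge0 // subr_ge0.
have [j0|j0] := leP 0 (mix (Em + Zm) 1).
  have [b [g [_ _ act mino good]]] := residual_loss_support n (mix Em x) z0.
  by exists b, g; split => //; exact: good.
exists 0, 0; split.
- rewrite residual_loss_eq0 ?mul0r ?addr0 //.
  by move: j0 z0; rewrite /mix; lra.
- by move=> e z z1; rewrite !mul0r addr0 residual_loss_ge0.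
- by rewrite /drift; lra.
Qed.

(** The greedy payoff for [m] outside I, in units where an accepted stage pays 1 instead of
    [1 - delta]. *)
Definition value_outside n (e z : R) : R :=
  concave_sum n (1 - z - eta * e) - residual_loss n e z.

(** On {E <= 0} the indicator lies below its concavification. On {E > 0}, with [s = e + z], bounding
    the loss at the image of the belief by the functional that supports it at the image of the
    rejected posterior leaves the gap [(1 - s) * (1 + delta * drift b g)]. *)
Lemma value_outside_step n (e z : R) : 0 <= z <= 1 -> e + z <= 1 ->
  (if z + eta * e <= 0 then 1 else 0 : R)
    + delta * value_outside n (mix Em e) (mix Zm z) <= value_outside n.+1 e z.
Proof.
move=> /andP[z0 z1] ez.
have a0 : z + eta * e <= 1.
  have [e0|e0] := leP e 0.
    by have := mulr_ge0_le0 (ltW eta_gt0) e0; lra.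
  by have := ler_wpM2r (ltW e0) eta_le1; lra.
have mixE : mix (1 - Zm - eta * Em) (1 - z - eta * e) =
    1 - mix Zm z - eta * mix Em e by rewrite /mix; ring.
rewrite /value_outside /= mixE.
have res0 : 0 <= delta * residual_loss n (mix Em e) (mix Zm z).
  by rewrite mulr_ge0 // residual_loss_ge0 // mix_ge0.
have [e0|e0] := leP e 0.
  have : (if z + eta * e <= 0 then 1 else 0 : R) <= Num.min 1 (1 - z - eta * e).
    by rewrite le_min; have [h|h] := leP (z + eta * e) 0; apply/andP; split; lra.
  by move: (if _ then _ else _) => D; lra.
have eta_e : 0 < eta * e by rewrite mulr_gt0.
rewrite (min_r (_ : 1 - z - eta * e <= 1)); last by lra.
rewrite (_ : (z + eta * e <= 0) = false) /=; last first.
  by apply/negbTE; rewrite -ltNge; lra.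
have [s [y [-> -> es zs [s0 sE y0 y1]]]] := simplex_normalize e0 z0.
have [|b [g [act mino good]]] := @residual_loss_edge_support n y.
  by rewrite (ltW y0).
rewrite -sE -act.
have h : b * mix Em e + g * mix Zm z <= residual_loss n (mix Em e) (mix Zm z).
  by apply: mino; rewrite mix_ge0.
have := ler_wpM2l delta_ge0 h.
have : 0 <= (1 - s) * (1 + delta * drift b g) by rewrite mulr_ge0 // sE; lra.
rewrite es zs /drift /mix; lra.
Qed.

Lemma value_outside_majorant n (e0 z0 : R) : 0 <= z0 ->
  exists k x y : R, k + x * e0 + y * z0 = value_outside n e0 z0 /\
    forall e z : R, 0 <= z -> value_outside n e z <= k + x * e + y * z.
Proof.
move=> z00; have [t Ht] := concave_sum_support n (1 - z0 - eta * e0).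
have [b [g [_ _ act mino _]]] := residual_loss_support n e0 z00.
exists (concave_sum n (1 - z0 - eta * e0) + t * (z0 + eta * e0)),
  (- t * eta - b), (- t - g); split.
  by rewrite /value_outside -act; ring.
move=> e z zz; have := Ht (1 - z - eta * e); have := mino e z zz.
by rewrite /value_outside; lra.
Qed.

(** The two shapes of an optimal split: on {E <= 0} the accepted posterior lies on F and the
    rejected one maximizes Z + eta E; on {E > 0} the accepted one is B+ and the rejected one lies on
    [B, C]. The factors [aI] allow an accepted posterior of weight 0, which is arbitrary. *)
Definition split_case (aI eI zI eJ zJ e z : R) :=
  [/\ e <= 0, eI <= 0, eJ <= 0, aI * (zI + eta * eI) = 0 & zJ + eta * eJ = 1]
  \/ [/\ 0 < e, aI * eI = 0, aI * zI = 0, 0 <= eJ <= 1 & zJ = 1 - eJ].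

(** At posteriors of positive weight every argument of [concave_sum] lies in [0,1], where it is
    affine and so unchanged by splitting; the accepted posterior has no residual loss. *)
Lemma value_outside_split n (aI aJ eI zI eJ zJ e z : R) :
  0 <= Zm + eta * Em -> 0 <= aI -> 0 <= aJ -> aI + aJ = 1 ->
  e = aI * eI + aJ * eJ -> z = aI * zI + aJ * zJ ->
  0 <= z <= 1 -> e + z <= 1 -> split_case aI eI zI eJ zJ e z ->
  value_outside n.+1 e z =
    aI * (1 + delta * value_outside n (mix Em eI) (mix Zm zI))
    + aJ * (delta * value_outside n (mix Em eJ) (mix Zm zJ)).
Proof.
move=> hm aI0 aJ0 aIJ eE zE /andP[z0 z1] ez cas.
pose mu := 1 - Zm - eta * Em.
have mu01 : 0 <= mu <= 1.
  move: (mulr_ge0_le0 (ltW eta_gt0) Em_le0) Zm_le1 hm; rewrite /mu => ? ? ?.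
  by apply/andP; split; lra.
have mix01 x : 0 <= x <= 1 -> 0 <= mix mu x <= 1.
  by case/andP: mu01 => ? ? /andP[? ?]; rewrite mix_ge0 // mix_le.
have [u [v aff]] := concave_sum_affine n mu01.
have mixE e' z' : 1 - mix Zm z' - eta * mix Em e' = mix mu (1 - z' - eta * e').
  by rewrite /mu /mix; ring.
rewrite /value_outside !mixE.
have mixEm0 x : x <= 0 -> mix Em x <= 0 by move=> ?; exact: mix_le.
case: cas => [[e0 eI0 eJ0 hI hJ]|[e0 eI0 zI0 eJ01 zJE]].
- have aJE : z + eta * e = aJ by rewrite eE zE; move: hI hJ; nra.
  rewrite !residual_loss_eq0 ?mixEm0 // !subr0 /= -/mu.
  rewrite (_ : 1 - z - eta * e = aI); last by lra.
  rewrite (_ : 1 - zJ - eta * eJ = 0); last by lra.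
  rewrite min_r; last by lra.
  rewrite (aff (mix mu aI)) ?(aff (mix mu 0)) ?mix01 ?ler01 ?lexx //; last first.
    by rewrite aI0; lra.
  (* Nothing locates the accepted posterior when [aI = 0], hence an equality weighted by [aI]. *)
  have hFI : aI * concave_sum n (mix mu (1 - zI - eta * eI)) = aI * (u + v * mix mu 1).
    have [->|aIn0] := eqVneq aI 0; first by rewrite !mul0r.
    move/eqP: hI; rewrite mulf_eq0 (negbTE aIn0) /= => /eqP hI.
    by rewrite (_ : 1 - zI - eta * eI = 1) ?aff ?mix01 //; lra.
  transitivity (aI + delta * (aI * concave_sum n (mix mu (1 - zI - eta * eI)))
    + aJ * (delta * (u + v * mix mu 0))); last by ring.
  have -> : aJ = 1 - aI by lra.
  by rewrite hFI /mix; ring.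
- case/andP: eJ01 => eJ0 eJ1.
  have aJ_gt0 : 0 < aJ.
    rewrite lt_def aJ0 andbT; apply/eqP => aJE.
    by move: e0; rewrite eE eI0 aJE mul0r addr0 ltxx.
  have sE : e + z = aJ by rewrite eE zE eI0 zI0 zJE; ring.
  have eJE : e / (e + z) = eJ by rewrite sE eE eI0; field; rewrite lt0r_neq0.
  have zJE' : z / (e + z) = zJ by rewrite sE zE zI0; field; rewrite lt0r_neq0.
  have eta_e : 0 < eta * e by rewrite mulr_gt0.
  have eta_e' : eta * e <= e by rewrite ler_piMl // ltW.
  have eta_eJ : 0 <= eta * eJ by rewrite mulr_ge0 // ltW.
  have eta_eJ' : eta * eJ <= eJ by rewrite ler_piMl.
  have hrI : aI * residual_loss n (mix Em eI) (mix Zm zI) = 0.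
    have [->|aIn0] := eqVneq aI 0; first by rewrite mul0r.
    move/eqP: eI0; rewrite mulf_eq0 (negbTE aIn0) /= => /eqP ->.
    by rewrite residual_loss_eq0 ?mulr0 // mixEm0.
  have hFI : aI * concave_sum n (mix mu (1 - zI - eta * eI)) = aI * (u + v * mix mu 1).
    have [->|aIn0] := eqVneq aI 0; first by rewrite !mul0r.
    move/eqP: eI0; rewrite mulf_eq0 (negbTE aIn0) /= => /eqP ->.
    move/eqP: zI0; rewrite mulf_eq0 (negbTE aIn0) /= => /eqP ->.
    by rewrite mulr0 !subr0 aff // mix01 // ler01 lexx.
  rewrite /= leNgt e0 /= eJE zJE' sE -/mu min_r; last by lra.
  have aff1 := aff _ (mix01 (1 - z - eta * e) _).
  have affJ := aff _ (mix01 (1 - zJ - eta * eJ) _).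
  rewrite aff1 ?affJ; try by apply/andP; split; lra.
  transitivity (aI + delta * (aI * concave_sum n (mix mu (1 - zI - eta * eI))
     - aI * residual_loss n (mix Em eI) (mix Zm zI)) + aJ * (delta *
    (u + v * mix mu (1 - zJ - eta * eJ) - residual_loss n (mix Em eJ) (mix Zm zJ)))); last by ring.
  rewrite hrI hFI /mix.
  have -> : e = aJ * eJ by rewrite eE eI0 add0r.
  have -> : z = aJ * (1 - eJ) by rewrite zE zI0 add0r zJE.
  have -> : aI = 1 - aJ by lra.
  by rewrite zJE; ring.
Qed.

Lemma value_outside_accept n (e z : R) : 0 <= z -> z + eta * e <= 0 ->
  value_outside n.+1 e z = 1 + delta * value_outside n (mix Em e) (mix Zm z).
Proof.
move=> z0 h; have e0 : e <= 0.
  by rewrite -(pmulr_rle0 _ eta_gt0); lra.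
rewrite /value_outside !residual_loss_eq0 ?mix_le // !subr0 /= min_l; last by lra.
by congr (_ + _ * concave_sum _ _); rewrite /mix; ring.
Qed.

(** * Recursions for an invariant distribution in I *)

Fixpoint horizon (n : nat) : R := if n is n'.+1 then 1 + delta * horizon n' else 0.

(** The mass rejected one stage after a rejected posterior with Z + eta E = 1 and E <= 0. *)
Let theta := Num.max 0 (mix (Zm + eta * Em) 1).

Fixpoint loss_rate (n : nat) : R :=
  if n is n'.+1 then 1 + delta * (loss_rate n' * theta) else 0.

(** The discounted rejected mass under the greedy rule. Only the rejected posterior contributes:
    with [m] in I, the transition maps I into itself. *)
Fixpoint rejection_loss (n : nat) (e z : R) : R :=
  if n is n'.+1 then
    if z + eta * e <= 0 then 0
    else if e <= 0 then loss_rate n'.+1 * (z + eta * e)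
    else (e + z) * (1 + delta *
         rejection_loss n' (mix Em (e / (e + z))) (mix Zm (z / (e + z))))
  else 0.

Let theta_ge0 : 0 <= theta. Proof. by rewrite le_max lexx. Qed.

Lemma loss_rate_ge0 n : 0 <= loss_rate n.
Proof. by elim: n => //= n IH; rewrite addr_ge0 // !mulr_ge0. Qed.

Lemma rejection_loss_ge0 n (e z : R) : 0 <= z -> 0 <= rejection_loss n e z.
Proof.
elim: n e z => //= n IH e z z0.
have [//|h] := leP (z + eta * e) 0.
have [e0|e0] := leP e 0.
  by have := mulr_ge0 (loss_rate_ge0 n.+1) (ltW h).
have s0 : 0 < e + z by lra.
rewrite mulr_ge0 ?(ltW s0) // addr_ge0 // mulr_ge0 //.
by apply: IH; rewrite mix_ge0 // divr_ge0 // ltW.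
Qed.

Lemma rejection_loss_eq0 n (e z : R) : z + eta * e <= 0 -> rejection_loss n e z = 0.
Proof. by case: n => //= n ->. Qed.

Lemma rejection_loss_ray n (e z : R) : e <= 0 ->
  rejection_loss n e z = loss_rate n * Num.max 0 (z + eta * e).
Proof.
case: n => [|n] /= e0; first by rewrite mul0r.
have [h|h] := leP (z + eta * e) 0; first by rewrite mulr0.
by rewrite e0.
Qed.

(** The right side is [loss_rate n.+1]: the rate increases with the horizon. *)
Lemma loss_rate_bound n : loss_rate n <= 1 + delta * (loss_rate n * theta).
Proof.
elim: n => [|n IH]; first by rewrite /= mul0r mulr0 addr0 ler01.
by rewrite [leLHS]/= lerD2l ler_wpM2l // ler_wpM2r.
Qed.

(** Here [delta * drift] equals [delta * loss_rate n * (theta - lam)], which [loss_rate_bound] and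
    [delta * lam <= 1] keep above -1. *)
Lemma loss_rate_drift n : 0 < mix (Zm + eta * Em) 1 ->
  0 <= 1 + delta * drift (eta * loss_rate n) (loss_rate n).
Proof.
move=> t0; have := loss_rate_bound n.
rewrite /theta max_r ?(ltW t0) // /drift /mix => h.
have c0 := loss_rate_ge0 n.
have : delta * lam * loss_rate n <= loss_rate n.
  by rewrite ler_piMl // mulr_ile1.
move: h; lra.
Qed.

(** The linear piece valid on {E <= 0} stays below the loss across E = 0: there the rejected mass
    [e + z] exceeds [z + eta * e], and [loss_rate_drift] makes the excess costly. *)
Lemma loss_rate_minorant n :
  minorant (rejection_loss n) (eta * loss_rate n) (loss_rate n).
Proof.
elim: n => [|n IH] e z z0; first by rewrite /= mulr0 !mul0r addr0.
rewrite (_ : _ + _ = loss_rate n.+1 * (z + eta * e)); last by ring.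
have c0 := loss_rate_ge0 n.+1.
have [e0|e0] := leP e 0.
  by rewrite rejection_loss_ray // ler_wpM2l // le_max lexx orbT.
have eta_e : 0 < eta * e by rewrite mulr_gt0.
have eta_e' : eta * e <= e by rewrite ler_piMl // ltW.
rewrite [leRHS]/=.
rewrite (_ : (z + eta * e <= 0) = false); last by apply/negbTE; rewrite -ltNge; lra.
rewrite (_ : (e <= 0) = false); last by apply/negbTE; rewrite -ltNge; lra.
have [s [y [-> -> es zs [s0 sE y0 y1]]]] := simplex_normalize e0 z0.
rewrite -sE.
have z'0 : 0 <= mix Zm (1 - y) by rewrite mix_ge0 // subr_ge0.
have h0 := rejection_loss_ge0 n (mix Em y) z'0.
have [t0|t0] := leP (mix (Zm + eta * Em) 1) 0.
  rewrite /= /theta max_l // !mulr0 addr0 mul1r mulrDr mulr1.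
  by have := mulr_ge0 (ltW s0) (mulr_ge0 delta_ge0 h0); lra.
have h := IH (mix Em y) _ z'0.
have good := loss_rate_drift n t0.
have := ler_wpM2l (ltW s0) (ler_wpM2l delta_ge0 h).
have : (z + eta * e) * (1 + delta * drift (eta * loss_rate n) (loss_rate n))
    <= s * (1 + delta * drift (eta * loss_rate n) (loss_rate n)).
  by rewrite ler_wpM2r //; lra.
rewrite /= /theta max_r ?(ltW t0) // es zs /drift /mix; lra.
Qed.

(** The last clause is requested only where the induction propagates it; [supported_edge] recovers
    it on the whole image of [B, C]. *)
Definition supported n := forall e z : R, 0 <= z ->
  exists b g : R, [/\ b * e + g * z = rejection_loss n e z,
    minorant (rejection_loss n) b g &
    0 < e -> 0 <= mix (Em + Zm) 1 ->
      [/\ 0 <= g, eta * g <= b & 0 <= 1 + delta * drift b g]].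

(** The image of an edge point lies in I, where 0 supports, or in {E <= 0}, where the [loss_rate]
    functional does, or in {E > 0}, where Z >= 0 forces E + Z >= 0 and the induction applies. *)
Lemma supported_edge n (x : R) : supported n -> 0 <= x <= 1 ->
  exists b g : R, [/\ b * mix Em x + g * mix Zm (1 - x)
      = rejection_loss n (mix Em x) (mix Zm (1 - x)),
    minorant (rejection_loss n) b g,
    0 <= g, eta * g <= b & 0 <= 1 + delta * drift b g].
Proof.
move=> sup /andP[x0 x1].
have z0 : 0 <= mix Zm (1 - x) by rewrite mix_ge0 // subr_ge0.
have [h|h] := leP (mix Zm (1 - x) + eta * mix Em x) 0.
  exists 0, 0; split => //.
  - by rewrite rejection_loss_eq0 // !mul0r addr0.
  - by move=> e z z1; rewrite !mul0r addr0 rejection_loss_ge0.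
  - by rewrite mulr0.
  - by rewrite /drift; lra.
have [e0|e0] := leP (mix Em x) 0.
  exists (eta * loss_rate n), (loss_rate n); split => //.
  - by rewrite rejection_loss_ray // max_r ?(ltW h) //; ring.
  - exact: loss_rate_minorant.
  - exact: loss_rate_ge0.
  - apply: loss_rate_drift; apply: (lt_le_trans h).
    have : lam * (eta * x) <= lam * x by rewrite ler_wpM2l // ler_piMl.
    by rewrite /mix; lra.
have [b [g [act mino good]]] := sup (mix Em x) _ z0.
have j0 : 0 <= mix (Em + Zm) 1 by move: e0 z0; rewrite /mix; lra.
by have [g0 bg d0] := good e0 j0; exists b, g.
Qed.

(** Homogeneity lifts the functional as for [residual_loss]. On {E <= 0} it must now stay below
    [loss_rate n.+1] times the positive part of Z + eta E, which follows from [0 <= g'],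
    [eta * g' <= b'] and [g' <= loss_rate n.+1]. *)
Lemma rejection_loss_supported n : Zm + eta * Em <= 0 -> supported n.
Proof.
move=> hm; elim: n => [|n IH] e z z0.
  exists 0, 0; split => /=; first by rewrite !mul0r addr0.
    by move=> e' z' _; rewrite !mul0r addr0.
  by move=> _ _; split => //; [rewrite mulr0|rewrite /drift; lra].
have [h|h] := leP (z + eta * e) 0.
  exists 0, 0; split.
  - by rewrite rejection_loss_eq0 // !mul0r addr0.
  - by move=> e' z' z1; rewrite !mul0r addr0 rejection_loss_ge0.
  - by move=> _ _; split => //; [rewrite mulr0|rewrite /drift; lra].
have [e0|e0] := leP e 0.
  exists (eta * loss_rate n.+1), (loss_rate n.+1); split => //.
  - by rewrite rejection_loss_ray // max_r ?(ltW h) //; ring.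
  - exact: loss_rate_minorant.
have [s [y [ey zy es zs [s0 sE y0 y1]]]] := simplex_normalize e0 z0.
have [|b [g [act mino g0 bg good]]] := supported_edge IH (_ : 0 <= y <= 1).
  by rewrite (ltW y0).
pose G := 1 + delta * drift b g.
pose b' := delta * lam * b + G.
pose g' := delta * lam * g + G.
have dl0 : 0 <= delta * lam by rewrite mulr_ge0.
have g'0 : 0 <= g' by rewrite addr_ge0 // mulr_ge0.
have bg' : eta * g' <= b'.
  have := ler_wpM2l dl0 bg; have := ler_wpM2r good eta_le1.
  by rewrite /b' /g' /G; lra.
(* [g'] is 1 plus [delta] times the functional at the image of C, where the loss equals
   [loss_rate n * theta]. *)
have g'c : g' <= loss_rate n.+1.
  have z1 : 0 <= mix Zm 1 by rewrite mix_ge0.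
  have := ler_wpM2l delta_ge0 (mino (mix Em 0) _ z1).
  rewrite rejection_loss_ray; last by rewrite mix_le.
  rewrite (_ : mix Zm 1 + eta * mix Em 0 = mix (Zm + eta * Em) 1); last by rewrite /mix; ring.
  by rewrite -/theta /= /g' /G /drift /mix; lra.
exists b', g'; split.
- rewrite /= (_ : (z + eta * e <= 0) = false); last by apply/negbTE; rewrite -ltNge.
  rewrite (_ : (e <= 0) = false); last by apply/negbTE; rewrite -ltNge.
  rewrite ey zy -sE -act es zs.
  by rewrite /b' /g' /G /drift /mix; ring.
- move=> e' z' z'0; have [e'0|e'0] := leP e' 0.
    rewrite rejection_loss_ray //.
    have h1 : b' * e' <= eta * g' * e' by rewrite ler_wnM2r.
    have [h2|h2] := leP (z' + eta * e') 0.
      by have := mulr_ge0_le0 g'0 h2; lra.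
    by have := ler_wpM2r (ltW h2) g'c; lra.
  have eta_e : 0 < eta * e' by rewrite mulr_gt0.
  rewrite /= (_ : (z' + eta * e' <= 0) = false); last by apply/negbTE; rewrite -ltNge; lra.
  rewrite (_ : (e' <= 0) = false); last by apply/negbTE; rewrite -ltNge.
  have [t [x [ex zx et zt [t0 tE x0 x1]]]] := simplex_normalize e'0 z'0.
  rewrite ex zx -tE.
  have h1 : b * mix Em x + g * mix Zm (1 - x) <=
      rejection_loss n (mix Em x) (mix Zm (1 - x)).
    by apply: mino; rewrite mix_ge0 ?subr_ge0.
  have := ler_wpM2l delta_ge0 (ler_wpM2l (ltW t0) h1).
  by rewrite et zt /b' /g' /G /drift /mix; lra.
- move=> _ j0; split => //.
  (* Uses [delta * drift b g = G - 1]. *)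
  have -> : drift b' g' = G * mix (Em + Zm) 1 - lam.
    by rewrite /b' /g' /G /drift /mix; ring.
  have := mulr_ge0 delta_ge0 (mulr_ge0 good j0).
  have : delta * lam <= 1 by rewrite mulr_ile1.
  by rewrite -/G; lra.
Qed.

Definition value_inside n (e z : R) : R := horizon n - rejection_loss n e z.

(** The same gap argument as for [value_outside_step], with the [loss_rate] functional on the part
    of {E <= 0} outside I and that of [supported_edge] on {E > 0}. *)
Lemma value_inside_step n (e z : R) : Zm + eta * Em <= 0 ->
  0 <= z <= 1 -> e + z <= 1 ->
  (if z + eta * e <= 0 then 1 else 0 : R)
    + delta * value_inside n (mix Em e) (mix Zm z) <= value_inside n.+1 e z.
Proof.
move=> hm /andP[z0 z1] ez; rewrite /value_inside.
have z'0 : 0 <= mix Zm z by rewrite mix_ge0.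
have r0 := mulr_ge0 delta_ge0 (rejection_loss_ge0 n (mix Em e) z'0).
have [h|h] := leP (z + eta * e) 0.
  by rewrite [rejection_loss n.+1 _ _]rejection_loss_eq0 //=; lra.
suff : rejection_loss n.+1 e z <= 1 + delta * rejection_loss n (mix Em e) (mix Zm z).
  by move: (rejection_loss n.+1 e z) => r /=; lra.
have [e0|e0] := leP e 0.
  have eta_e := mulr_ge0_le0 (ltW eta_gt0) e0.
  rewrite rejection_loss_ray // max_r ?(ltW h) //=.
  have [t0|t0] := leP (mix (Zm + eta * Em) 1) 0.
    by rewrite /theta max_l // !mulr0 addr0 mul1r; lra.
  have := ler_wpM2l delta_ge0 (loss_rate_minorant n (mix Em e) z'0).
  have y1 : 0 <= 1 - (z + eta * e) by lra.
  have := mulr_ge0 y1 (loss_rate_drift n t0).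
  by rewrite /theta max_r ?(ltW t0) // /drift /mix; lra.
rewrite [leLHS]/= (_ : (z + eta * e <= 0) = false); last by apply/negbTE; rewrite -ltNge.
rewrite (_ : (e <= 0) = false); last by apply/negbTE; rewrite -ltNge.
have [s [y [-> -> es zs [s0 sE y0 y1]]]] := simplex_normalize e0 z0.
have [|b [g [act mino g0 bg good]]] :=
    supported_edge (@rejection_loss_supported n hm) (_ : 0 <= y <= 1).
  by rewrite (ltW y0).
rewrite -sE -act.
have h1 := ler_wpM2l delta_ge0 (mino (mix Em e) _ z'0).
have : 0 <= (1 - s) * (1 + delta * drift b g) by rewrite mulr_ge0 // sE; lra.
by move: h1; rewrite es zs /drift /mix; lra.
Qed.

Lemma value_inside_majorant n (e0 z0 : R) : Zm + eta * Em <= 0 -> 0 <= z0 ->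
  exists k x y : R, k + x * e0 + y * z0 = value_inside n e0 z0 /\
    forall e z : R, 0 <= z -> value_inside n e z <= k + x * e + y * z.
Proof.
move=> hm z00; have [b [g [act mino _]]] := @rejection_loss_supported n hm e0 _ z00.
exists (horizon n), (- b), (- g); split; first by rewrite /value_inside -act; ring.
by move=> e z zz; have := mino e z zz; rewrite /value_inside; lra.
Qed.

Lemma rejection_loss_mix_eq0 n (e z : R) : Zm + eta * Em <= 0 -> z + eta * e <= 0 ->
  rejection_loss n (mix Em e) (mix Zm z) = 0.
Proof.
move=> hm h; apply: rejection_loss_eq0.
by rewrite (_ : _ + _ = mix (Zm + eta * Em) (z + eta * e)) ?mix_le // /mix; ring.
Qed.

Lemma value_inside_accept n (e z : R) : Zm + eta * Em <= 0 -> z + eta * e <= 0 ->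
  value_inside n.+1 e z = 1 + delta * value_inside n (mix Em e) (mix Zm z).
Proof.
move=> hm h; rewrite /value_inside rejection_loss_mix_eq0 //.
by rewrite rejection_loss_eq0 // !subr0.
Qed.

Lemma value_inside_split n (aI aJ eI zI eJ zJ e z : R) :
  Zm + eta * Em <= 0 -> zI + eta * eI <= 0 -> 0 < z + eta * e ->
  0 <= aI -> 0 <= aJ -> aI + aJ = 1 ->
  e = aI * eI + aJ * eJ -> z = aI * zI + aJ * zJ ->
  split_case aI eI zI eJ zJ e z ->
  value_inside n.+1 e z =
    aI * (1 + delta * value_inside n (mix Em eI) (mix Zm zI))
    + aJ * (delta * value_inside n (mix Em eJ) (mix Zm zJ)).
Proof.
move=> hm hI0 h aI0 aJ0 aIJ eE zE cas.
rewrite /value_inside (@rejection_loss_mix_eq0 n eI) //.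
have aIE : aI = 1 - aJ by lra.
case: cas => [[e0 eI0 eJ0 hI hJ]|[e0 eI0 zI0 eJ01 zJE]].
- have aJE : z + eta * e = aJ by rewrite eE zE; move: hI hJ; nra.
  rewrite !rejection_loss_ray ?mix_le // max_r ?(ltW h) //.
  rewrite (_ : mix Zm zJ + _ = mix (Zm + eta * Em) (zJ + eta * eJ)); last by rewrite /mix; ring.
  by rewrite hJ -/theta aJE aIE /=; ring.
- have aJ_gt0 : 0 < aJ.
    rewrite lt_def aJ0 andbT; apply/eqP => aJE.
    by move: e0; rewrite eE eI0 aJE mul0r addr0 ltxx.
  have sE : e + z = aJ by rewrite eE zE eI0 zI0 zJE; ring.
  have eJE : e / (e + z) = eJ by rewrite sE eE eI0; field; rewrite lt0r_neq0.
  have zJE' : z / (e + z) = zJ by rewrite sE zE zI0; field; rewrite lt0r_neq0.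
  rewrite /= (_ : (z + eta * e <= 0) = false); last by apply/negbTE; rewrite -ltNge.
  rewrite (_ : (e <= 0) = false); last by apply/negbTE; rewrite -ltNge.
  by rewrite eJE zJE' sE aIE; ring.
Qed.

End ScalarRecursions.

(** * Integration over beliefs *)

Section LowerIntegral.
Context d (T : measurableType d) (R : realType).

Lemma ge0_le_integralT (mu : {measure set T -> \bar R}) (f g : T -> \bar R) :
  (forall x, 0 <= f x)%E -> (forall x, f x <= g x)%E ->
  (\int[mu]_x f x <= \int[mu]_x g x)%E.
Proof.
move=> f0 fg; have g0 x : (0 <= g x)%E by exact: le_trans (fg x).
rewrite !ge0_integralTE //; apply: le_ereal_sup => _ [h hf <-].
by exists h => // x; exact: le_trans (hf x) (fg x).
Qed.

End LowerIntegral.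

Section Beliefs.
Context (R : realType).
Implicit Types (p q : belief R) (l : 'I_3 -> R).

Lemma measurable_coord i : measurable_fun [set: belief R] (fun p => coord p i).
Proof.
rewrite /coord; case: (val i) => [|[|k]].
- by apply: measurableT_comp => //; exact: measurable_fst.
- by apply: measurableT_comp => //; exact: measurable_fst.
- exact: measurable_snd.
Qed.

Lemma measurable_inner l : measurable_fun [set: belief R] (fun p => inner p l).
Proof.
rewrite /inner; apply: measurable_sum => i.
by apply: measurable_funM => //; exact: measurable_coord.
Qed.

Lemma measurable_inSimplex : measurable [set p : belief R | inSimplex p].
Proof.
rewrite (_ : [set _ | _] =
  \bigcap_(i in [set: 'I_3]) ((fun p => coord p i) @^-1` `[0, +oo[)
  `&` (fun p : belief R => inner p (fun=> 1)) @^-1` [set 1]); last first.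
  apply/seteqP; split => p /=.
    move=> [p0 p1]; split; first by move=> i _ /=; rewrite in_itv /= p0.
    by rewrite -[RHS]p1; apply: eq_bigr => i _; rewrite mulr1.
  move=> [p0 p1]; split.
    by move=> i; have := p0 i Logic.I; rewrite /= in_itv /= andbT.
  by rewrite -[RHS]p1; apply: eq_bigr => i _; rewrite mulr1.
apply: measurableI.
  apply: fin_bigcap_measurable => // i _; rewrite -[X in measurable X]setTI.
  exact: measurable_coord.
rewrite -[X in measurable X]setTI; exact: measurable_inner.
Qed.

Lemma inSimplex_le1 p i : inSimplex p -> coord p i <= 1.
Proof.
move=> [p0 <-]; rewrite (bigD1 i) //= lerDl; exact: sumr_ge0.
Qed.

(** Coordinates are bounded on the simplex, which has full measure; restricting to it gives the
    integrability that linearity requires. *)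
Lemma integral_inner (mu : probability (belief R) R) p l : splitting mu p ->
  (\int[mu]_(q in [set q | inSimplex q]) (inner q l)%:E)%E = (inner p l)%:E.
Proof.
move=> [muS mean]; pose S := [set q : belief R | inSimplex q].
have mS : measurable S := measurable_inSimplex.
have muSC : mu (~` S) = 0%E by rewrite probability_setC // muS subee.
have icoord i : mu.-integrable S (fun q => (coord q i)%:E).
  apply: measurable_bounded_integrable => //.
  - by apply: (le_lt_trans (probability_le1 mu mS)); rewrite ltry.
  - by apply: measurable_funTS; exact: measurable_coord.
  - exists 1; split => // x x1 q Sq /=.
    by rewrite ger0_norm ?(le_trans (inSimplex_le1 i Sq)) ?(ltW x1)//; case: Sq.
have intS i : (\int[mu]_(q in S) (coord q i)%:E = (coord p i)%:E)%E.
  rewrite -mean integral_mkcond; apply: ae_eq_integral => //.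
  - apply/(measurable_restrictT _ mS)/measurable_EFinP/measurable_funTS.
    exact: measurable_coord.
  - by apply/measurable_EFinP; exact: measurable_coord.
  - exists (~` S); split => //; first exact: measurableC.
    by move=> q /= h Sq; apply: h => _; rewrite patchE mem_set.
rewrite /inner -sumEFin.
under eq_integral do rewrite -sumEFin.
have mulE i : (fun q => (coord q i * l i)%:E) = (fun q => (l i)%:E * (coord q i)%:E)%E.
  by apply/funext => q; rewrite -EFinM mulrC.
rewrite integral_sum //; last by move=> i; rewrite mulE; exact: integrableZl.
by apply: eq_bigr => i _; rewrite mulE integralZl // intS -EFinM mulrC.
Qed.

Lemma integral_le_inner (mu : probability (belief R) R) p l (f : belief R -> \bar R) :
  splitting mu p -> (forall q, 0 <= f q)%E ->
  (forall q, inSimplex q -> f q <= (inner q l)%:E)%E ->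
  (\int[mu]_q f q <= (inner p l)%:E)%E.
Proof.
move=> spl f0 fl; have muS := spl.1; rewrite -(integral_inner l spl).
set S := [set q : belief R | inSimplex q].
have mS : measurable S := measurable_inSimplex.
have muSC : mu (~` S) = 0%E by rewrite probability_setC // muS subee.
have mI : measurable_fun [set: belief R] ((fun q => (inner q l)%:E) \_ S).
  apply/(measurable_restrictT _ mS)/measurable_EFinP/measurable_funTS.
  exact: measurable_inner.
(* Off the simplex [f] is only known to be nonnegative, so the measurable bound takes the value
   [+oo] there, on a null set. *)
have mO : measurable_fun [set: belief R] ((cst +oo%E : belief R -> \bar R) \_ (~` S)).
  by apply/(measurable_restrictT _ (measurableC mS)); exact: measurable_cst.
have I0 q : (0 <= ((fun q => (inner q l)%:E) \_ S) q)%E.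
  by rewrite patchE; case: ifPn => // /set_mem Sq; exact: le_trans (fl _ Sq).
have O0 q : (0 <= ((cst +oo%E : belief R -> \bar R) \_ (~` S)) q)%E.
  by rewrite patchE; case: ifPn => //= _; rewrite leey.
apply: (@le_trans _ _ (\int[mu]_q (((fun q => (inner q l)%:E) \_ S) q +
   ((cst +oo%E : belief R -> \bar R) \_ (~` S)) q))%E).
  apply: ge0_le_integralT => // q.
  have [Sq|Sq] := pselect (S q).
    rewrite !patchE mem_set // memNset ?adde0; last by apply.
    exact: fl.
  by rewrite !patchE memNset // mem_set // add0e leey.
rewrite [leRHS]integral_mkcond le_eqVlt; apply/orP; left; apply/eqP.
apply: ge0_ae_eq_integral => //.
- exact: emeasurable_funD.
- by move=> q _; exact: adde_ge0.
- exists (~` S); split => //; first exact: measurableC.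
  move=> q /= h Sq; apply: h => _.
  by rewrite !patchE mem_set // memNset ?adde0 //; apply.
Qed.

(** * Integrals against two-point measures *)

Section TwoPoints.
Context (mu : probability (belief R) R) (aI aJ : R) (qI qJ : belief R).
Hypotheses (aI0 : 0 <= aI) (aJ0 : 0 <= aJ).
Hypothesis muE : forall A, measurable A ->
  mu A = (aI%:E * \d_qI A + aJ%:E * \d_qJ A)%E.

Lemma ge0_integral_two_points (f : belief R -> \bar R) :
  (forall q, 0 <= f q)%E -> measurable_fun setT f ->
  (\int[mu]_q f q = aI%:E * f qI + aJ%:E * f qJ)%E.
Proof.
move=> f0 mf.
pose m1 := mscale (NngNum aI0) (\d_qI : {measure set (belief R) -> \bar R}).
pose m2 := mscale (NngNum aJ0) (\d_qJ : {measure set (belief R) -> \bar R}).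
rewrite (eq_measure_integral (measure_add m1 m2)); last first.
  by move=> A mA _; rewrite [LHS]muE //; exact/esym/measure_addE.
rewrite ge0_integral_measure_add // !ge0_integral_mscale //.
by rewrite !integral_dirac // !diracT !mul1e.
Qed.

Lemma integral_two_points (f : belief R -> R) : measurable_fun setT f ->
  (\int[mu]_q (f q)%:E = (aI * f qI + aJ * f qJ)%:E)%E.
Proof.
move=> mf; have mf' : measurable_fun setT (EFin \o f) by exact/measurable_EFinP.
rewrite integralE !ge0_integral_two_points //; last 2 first.
- exact: measurable_funeneg.
- exact: measurable_funepos.
rewrite !funeposE !funenegE /= -!EFin_max -!EFinM -!EFinD.
congr (_%:E).
have maxB x : Num.max x 0 - Num.max (- x) 0 = x :> R.
  have [x0|x0] := leP x 0.
    by rewrite max_l ?opprK ?oppr_ge0 // add0r.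
  by rewrite max_r ?subr0 // oppr_le0 ltW.
by rewrite opprD addrACA -!mulrBr !maxB.
Qed.

Lemma measurable_set1_belief q : measurable [set q].
Proof.
rewrite (_ : [set q] = \bigcap_(i in [set: 'I_3])
    ((fun p => coord p i) @^-1` [set coord q i])); last first.
  apply/seteqP; split => [_ -> //|p h /=].
  have h0 := h (inord 0) Logic.I; have h1 := h (inord 1) Logic.I.
  have h2 := h (inord 2) Logic.I.
  move: h0 h1 h2; rewrite /coord /= !inordK //=.
  by case: p {h} => [[? ?] ?]; case: q => [[? ?] ?] /= -> -> ->.
apply: fin_bigcap_measurable => // i _; rewrite -[X in measurable X]setTI.
by apply: measurable_coord => //; exact: measurable_set1.
Qed.

(** The restriction of [f] to the two atoms is measurable whatever [f] is, and lies below [f]. *)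
Lemma integral_two_points_ge (f : belief R -> \bar R) :
  (forall q, 0 <= f q)%E ->
  (aI%:E * f qI + aJ%:E * f qJ <= \int[mu]_q f q)%E.
Proof.
move=> f0; pose D := [set qI; qJ].
have mD : measurable D by apply: measurableU; exact: measurable_set1_belief.
have fD0 q : (0 <= (f \_ D) q)%E by rewrite patchE; case: ifPn.
have mfD : measurable_fun setT (f \_ D).
  apply/(measurable_restrictT _ mD) => _ Y mY.
  have -> : D `&` f @^-1` Y = ([set qI] `&` [set _ | Y (f qI)])
      `|` ([set qJ] `&` [set _ | Y (f qJ)]).
    apply/seteqP; split => q /=; first by move=> [[-> ?|-> ?]]; [left|right].
    by move=> [[-> ?]|[-> ?]]; split => //; [left|right].
  have mcase x (P : Prop) : measurable ([set x] `&` [set _ : belief R | P]).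
    have [h|h] := pselect P.
      rewrite (_ : _ `&` _ = [set x]); first exact: measurable_set1_belief.
      by apply/seteqP; split => [y []|y ->].
    rewrite (_ : _ `&` _ = set0) //.
    by apply/seteqP; split => [y []|y].
  by apply: measurableU; exact: mcase.
apply: (@le_trans _ _ (\int[mu]_q (f \_ D) q)%E).
  rewrite ge0_integral_two_points // !patchE !mem_set //; [by right|by left].
apply: ge0_le_integralT => // q; rewrite patchE; case: ifPn => // _.
Qed.

End TwoPoints.
End Beliefs.

(** * Verification of the greedy strategy *)

Section Verification.
Context (R : realType) (r : 'I_3 -> R) (delta : R) (M : 'M[R]_3).
Hypotheses (delta_ge0 : 0 <= delta) (delta_le1 : delta <= 1).
Hypothesis phi_simplex : forall q, inSimplex q -> inSimplex (phi M q).
Context (W : nat -> belief R -> R).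
Hypothesis W0 : forall p, W 0 p = 0.

Lemma cur_belief_rcons p1 h q : cur_belief M p1 (rcons h q) = phi M q.
Proof. by rewrite /cur_belief map_rcons last_rcons. Qed.

Lemma inSimplex_cur_belief p1 h : inSimplex p1 ->
  all (fun q => `[< inSimplex q >]) h -> inSimplex (cur_belief M p1 h).
Proof.
move=> p1S; case/lastP: h => // h q; rewrite all_rcons => /andP[/asboolP qS _].
by rewrite cur_belief_rcons; exact: phi_simplex.
Qed.

Lemma payoffN_ge0 s N h : (0 <= payoffN r delta s N h)%E.
Proof.
elim: N h => //= N IH h; apply: integral_ge0 => q _.
by rewrite adde_ge0 ?mule_ge0 ?lee_fin // mulr_ge0 ?subr_ge0 // indicE.
Qed.

(** A splitting has the current belief as mean, so the affine majorant integrates to its value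
    there, which is [W N.+1]. *)
Lemma payoffN_le s p1 N h :
  (forall n p, inSimplex p -> exists l, inner p l = W n.+1 p /\
    forall q, inSimplex q ->
      \1_[set x | inI r x] q + delta * W n (phi M q) <= inner q l) ->
  admissible M p1 s -> inSimplex p1 ->
  all (fun q => `[< inSimplex q >]) h ->
  (payoffN r delta s N h <= ((1 - delta) * W N (cur_belief M p1 h))%:E)%E.
Proof.
move=> majo adm p1S; elim: N h => [|N IH] h hS; first by rewrite /= W0 mulr0.
have [l [<- lP]] := majo N _ (inSimplex_cur_belief p1S hS).
have innerZ q : (1 - delta) * inner q l = inner q (fun i => (1 - delta) * l i).
  by rewrite /inner mulr_sumr; apply: eq_bigr => i _; rewrite mulrCA.
rewrite innerZ /=; apply: integral_le_inner; first exact: adm.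
  by move=> q; rewrite adde_ge0 ?mule_ge0 ?lee_fin ?payoffN_ge0 //
    mulr_ge0 ?subr_ge0 // indicE.
move=> q qS; rewrite -innerZ.
have := IH (rcons h q); rewrite all_rcons hS andbT cur_belief_rcons.
move/(_ (introT (asboolP _) qS)) => ub.
apply: (@le_trans _ _ (((1 - delta) * \1_[set x | inI r x] q)%:E +
    delta%:E * ((1 - delta) * W N (phi M q))%:E)%E).
  by rewrite leeD2l // lee_wpmul2l // lee_fin.
rewrite -EFinM -EFinD lee_fin mulrCA -mulrDr ler_wpM2l ?subr_ge0 //.
exact: lP.
Qed.

(** The Dirac choice on I is treated as a split with weights 1 and 0. *)
Lemma greedy_choice_two_points mu p : inSimplex p -> greedy_choice r mu p ->
  exists (aI aJ : R) (qI qJ : belief R),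
    [/\ feasible_split r p aI aJ qI qJ,
        forall A, measurable A -> mu A = (aI%:E * \d_qI A + aJ%:E * \d_qJ A)%E,
        inI r p -> [/\ aI = 1, aJ = 0 & qI = p] &
        ~ inI r p -> forall aI' aJ' qI' qJ',
          feasible_split r p aI' aJ' qI' qJ' -> aI' <= aI].
Proof.
move=> pS [gI gJ]; have [pI|pI] := pselect (inI r p).
  exists 1, 0, p, p; split => //.
  - by split=> [|||i]; rewrite ?mul1r ?mul0r ?addr0 // ler01 lexx.
  - by move=> A mA; rewrite gI // mul1e mul0e adde0.
by have [aI [aJ [qI [qJ [feas opt muE]]]]] := gJ pI; exists aI, aJ, qI, qJ; split.
Qed.

Lemma greedy_choice_splitting mu p : inSimplex p -> greedy_choice r mu p ->
  splitting mu p.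
Proof.
move=> pS /(greedy_choice_two_points pS)[aI [aJ [qI [qJ [feas muE _ _]]]]].
have [[aI0 aJ0 aIJ] [qIS _] qJS pE] := feas.
split.
  rewrite muE; last exact: measurable_inSimplex.
  by rewrite !diracE !mem_set // !mule1 -EFinD aIJ.
move=> i; rewrite (integral_two_points aI0 aJ0 muE) ?pE //.
exact: measurable_coord.
Qed.

(** A lower bound suffices, [payoffN_le] being the converse, so evaluation at the two atoms replaces
    measurability of the continuation payoff. *)
Lemma le_payoffN_greedy g p1 N h :
  (forall n p, inI r p -> W n.+1 p = 1 + delta * W n (phi M p)) ->
  (forall n p aI aJ qI qJ, inSimplex p -> ~ inI r p ->
    feasible_split r p aI aJ qI qJ ->
    (forall aI' aJ' qI' qJ', feasible_split r p aI' aJ' qI' qJ' -> aI' <= aI) ->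
    W n.+1 p = aI * (1 + delta * W n (phi M qI)) + aJ * (delta * W n (phi M qJ))) ->
  greedy_selector r g -> inSimplex p1 ->
  all (fun q => `[< inSimplex q >]) h ->
  (((1 - delta) * W N (cur_belief M p1 h))%:E <=
    payoffN r delta (greedy_strategy M p1 g) N h)%E.
Proof.
move=> Wacc Wsplit gr p1S; elim: N h => [|N IH] h hS; first by rewrite /= W0 mulr0.
have pS := inSimplex_cur_belief p1S hS; set p := cur_belief M p1 h in pS *.
have [aI [aJ [qI [qJ [feas muE optI optJ]]]]] := greedy_choice_two_points pS (gr p pS).
have [[aI0 aJ0 aIJ] qII qJS pE] := feas.
pose F q := (((1 - delta) * \1_[set x | inI r x] q)%:E
        + delta%:E * payoffN r delta (greedy_strategy M p1 g) N (rcons h q))%E.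
have F0 q : (0 <= F q)%E.
  by rewrite adde_ge0 ?mule_ge0 ?lee_fin ?payoffN_ge0 //
    mulr_ge0 ?subr_ge0 // indicE.
rewrite [leRHS]/=.
apply: (le_trans _ (integral_two_points_ge aI0 aJ0 muE F0)).
have FE q : inSimplex q -> (((1 - delta) * (\1_[set x | inI r x] q
    + delta * W N (phi M q)))%:E <= F q)%E.
  move=> qS; have := IH (rcons h q); rewrite all_rcons hS andbT cur_belief_rcons.
  move/(_ (introT (asboolP _) qS)) => lb.
  rewrite mulrDr EFinD leeD2l // mulrCA EFinM lee_wpmul2l //.
have F_I : (((1 - delta) * (1 + delta * W N (phi M qI)))%:E <= F qI)%E.
  by have := FE _ qII.1; rewrite indicE mem_set.
have F_J : (((1 - delta) * (delta * W N (phi M qJ)))%:E <= F qJ)%E.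
  apply: le_trans (FE _ qJS); rewrite lee_fin ler_wpM2l ?subr_ge0 //.
  by rewrite lerDr indicE.
apply: (@le_trans _ _ (aI%:E * ((1 - delta) * (1 + delta * W N (phi M qI)))%:E
    + aJ%:E * ((1 - delta) * (delta * W N (phi M qJ)))%:E)%E); last first.
  by rewrite leeD // lee_wpmul2l // lee_fin.
rewrite -!EFinM -EFinD lee_fin.
have [pI|pI] := pselect (inI r p).
  by have [-> -> ->] := optI pI; rewrite Wacc // mul0r addr0 mul1r.
rewrite (Wsplit N p aI aJ qI qJ) //; last exact: optJ.
by rewrite le_eqVlt; apply/orP; left; apply/eqP; ring.
Qed.

(** At each horizon [N], [(1 - delta) * W N p1] lies above the payoff of any admissible strategy and
    below that of the greedy one; the suprema over [N] then compare. *)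
Lemma greedy_optimal g p1 :
  (forall n p, inSimplex p -> exists l, inner p l = W n.+1 p /\
    forall q, inSimplex q ->
      \1_[set x | inI r x] q + delta * W n (phi M q) <= inner q l) ->
  (forall n p, inI r p -> W n.+1 p = 1 + delta * W n (phi M p)) ->
  (forall n p aI aJ qI qJ, inSimplex p -> ~ inI r p ->
    feasible_split r p aI aJ qI qJ ->
    (forall aI' aJ' qI' qJ', feasible_split r p aI' aJ' qI' qJ' -> aI' <= aI) ->
    W n.+1 p = aI * (1 + delta * W n (phi M qI)) + aJ * (delta * W n (phi M qJ))) ->
  greedy_selector r g -> inSimplex p1 ->
  optimal_at r delta M p1 (greedy_strategy M p1 g).
Proof.
move=> majo Wacc Wsplit gr p1S.
have adm : admissible M p1 (greedy_strategy M p1 g).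
  move=> h hS; have pS := inSimplex_cur_belief p1S hS.
  by apply: greedy_choice_splitting => //; exact: gr.
split => //; apply/eqP; rewrite eq_le; apply/andP; split.
  by apply: ereal_sup_ubound; exists (greedy_strategy M p1 g).
apply: ge_ereal_sup => _ [s sadm <-]; apply: ge_ereal_sup => _ [N _ <-].
apply: (le_trans (payoffN_le N majo sadm p1S (erefl : all _ [::]))).
apply: (le_trans (le_payoffN_greedy N Wacc Wsplit gr p1S (erefl : all _ [::]))).
by apply: ereal_sup_ubound; exists N.
Qed.

End Verification.

(** * Reduction to the plane *)


Section Geometry.
Context (R : realType).
Implicit Types (p q m : belief R) (v r : 'I_3 -> R).

Lemma coord_mkbelief (f : 'I_3 -> R) i : coord (mkbelief f) i = f i.
Proof.
rewrite /coord /mkbelief.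
by case: i => [[|[|[|//]]]] /= lt3; congr f; apply/val_inj; rewrite /= inordK.
Qed.

Lemma ord3_third (A B C i : 'I_3) : A != B -> A != C -> B != C ->
  i != A -> i != B -> i = C.
Proof.
move: A B C i; do 4![case=> [[|[|[|//]]] ?]] => // *; exact/val_inj.
Qed.

Lemma sum_ord3 (f : 'I_3 -> R) (A B C : 'I_3) : A != B -> A != C -> B != C ->
  \sum_i f i = f A + f B + f C.
Proof.
move=> AB AC BC.
rewrite (bigD1 A) //= (bigD1 B) /=; last by rewrite eq_sym.
rewrite (bigD1 C) /=; last by rewrite eq_sym AC eq_sym.
rewrite big_pred0 ?addr0 ?addrA // => i; apply/negbTE.
rewrite !negb_and !negbK; have [//|iA /=] := eqVneq i A.
by have [//|iB /=] := eqVneq i B; apply/eqP; exact: (ord3_third AB AC BC).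
Qed.

Lemma inner_affine p (s t : R) q q' v :
  (forall i, coord p i = s * coord q i + t * coord q' i) ->
  inner p v = s * inner q v + t * inner q' v.
Proof.
move=> pE; rewrite /inner !mulr_sumr -big_split; apply: eq_bigr => i _ /=.
by rewrite pE; ring.
Qed.

Lemma coord_phi lam m q j : inSimplex q ->
  coord (phi (trans lam m) q) j = (1 - lam) * coord m j + lam * coord q j.
Proof.
move=> [_ q1]; rewrite /phi coord_mkbelief.
under eq_bigr do rewrite mxE mulrDr.
rewrite big_split /= -mulr_suml q1 mul1r; congr (_ + _).
rewrite (bigD1 j) //= eqxx big1 ?addr0 1?mulrC // => i ij.
by rewrite (negbTE ij) mulr0.
Qed.

Lemma inner_phi lam m q v : inSimplex q ->
  inner (phi (trans lam m) q) v = mix lam (inner m v) (inner q v).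
Proof. by move=> qS; apply: inner_affine => i; exact: coord_phi. Qed.

Lemma inSimplex_phi lam m q : 0 <= lam -> lam <= 1 -> inSimplex m ->
  inSimplex q -> inSimplex (phi (trans lam m) q).
Proof.
move=> l0 l1 mS qS; split.
  move=> i; rewrite coord_phi //.
  by rewrite addr_ge0 // mulr_ge0 ?subr_ge0 //; [case: mS|case: qS].
under eq_bigr do rewrite coord_phi //.
by rewrite big_split /= -!mulr_sumr mS.2 qS.2 !mulr1 subrK.
Qed.

Lemma inner_le p v (k : R) : inSimplex p -> (forall i, v i <= k) -> inner p v <= k.
Proof.
move=> [p0 p1] vk; rewrite -[leRHS]mul1r -p1 mulr_suml.
by apply: ler_sum => i _; rewrite ler_wpM2l.
Qed.

Lemma inner_ge0 p v : inSimplex p -> (forall i, 0 <= v i) -> 0 <= inner p v.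
Proof. by move=> [p0 _] v0; apply: sumr_ge0 => i _; rewrite mulr_ge0. Qed.

Lemma innerDv p v v' : inner p v + inner p v' = inner p (fun i => v i + v' i).
Proof. by rewrite /inner -big_split; apply: eq_bigr => i _; rewrite /= mulrDr. Qed.

Lemma innerZv p (k : R) v : k * inner p v = inner p (fun i => k * v i).
Proof. by rewrite /inner mulr_sumr; apply: eq_bigr => i _; rewrite mulrCA. Qed.

Lemma inner_cst p (k : R) : inSimplex p -> inner p (fun=> k) = k.
Proof. by move=> [_ p1]; rewrite /inner -mulr_suml p1 mul1r. Qed.

Lemma inSimplex_vertex A : inSimplex (vertex R A).
Proof.
split=> [i|]; first by rewrite coord_mkbelief; case: ifP.
under eq_bigr do rewrite coord_mkbelief.
by rewrite -big_mkcond /= big_pred1_eq.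
Qed.

Lemma inner_vertex A v : inner (vertex R A) v = v A.
Proof.
rewrite /inner (bigD1 A) //= big1 => [|i iA].
  by rewrite coord_mkbelief eqxx mul1r addr0.
by rewrite coord_mkbelief (negbTE iA) mul0r.
Qed.

(* [x] is the part of the mass of [p] that is put on the rejected posterior. *)
Lemma feasible_split_of_part r p (x : 'I_3 -> R) A : inSimplex p -> 0 <= r A ->
  (forall i, 0 <= x i <= coord p i) -> 0 < \sum_i x i ->
  0 <= inner p r - \sum_i x i * r i ->
  exists aI qI qJ, feasible_split r p aI (\sum_i x i) qI qJ.
Proof.
move=> [p0 p1] rA xp; set y := \sum_i x i => y0 res.
have x0 i : 0 <= x i by case/andP: (xp i).
have xle i : x i <= coord p i by case/andP: (xp i).
have y1 : y <= 1 by rewrite -p1; exact: ler_sum.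
have resE : inner p r - \sum_i x i * r i = \sum_i (coord p i - x i) * r i.
  by rewrite /inner -sumrB; apply: eq_bigr => i _; rewrite mulrBl.
pose qJ := mkbelief (fun i => x i / y).
have qJS : inSimplex qJ.
  split=> [i|]; first by rewrite coord_mkbelief divr_ge0 // ltW.
  under eq_bigr do rewrite coord_mkbelief.
  by rewrite -mulr_suml -/y divff // lt0r_neq0.
have [y1'|yn1] := eqVneq y 1.
  (* Everything is rejected, and the accepted posterior of weight 0 may be any point of I. *)
  exists 0, (vertex R A), qJ; split => //.
  - by rewrite y1' add0r lexx ler01.
  - by split; [exact: inSimplex_vertex|rewrite inner_vertex].
  - move=> i; rewrite mul0r add0r coord_mkbelief mulrCA divff ?lt0r_neq0 // mulr1.
    apply/eqP; rewrite -subr_eq0; apply/eqP.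
    have /eqP : \sum_i (coord p i - x i) = 0 by rewrite sumrB p1 -/y y1' subrr.
    rewrite psumr_eq0 => [/allP h|j _]; last by rewrite subr_ge0.
    by apply/eqP/h; rewrite mem_index_enum.
have s0 : 0 < 1 - y by rewrite subr_gt0 lt_neqAle yn1.
pose qI := mkbelief (fun i => (coord p i - x i) / (1 - y)).
exists (1 - y), qI, qJ; split => //.
- by split; [exact: ltW|exact: ltW|rewrite subrK].
- split; first split.
  + by move=> i; rewrite coord_mkbelief divr_ge0 ?subr_ge0 // ltW.
  + under eq_bigr do rewrite coord_mkbelief.
    by rewrite -mulr_suml sumrB p1 divff // lt0r_neq0.
  + rewrite /inner; under eq_bigr do rewrite coord_mkbelief mulrAC.
    by rewrite -mulr_suml -resE divr_ge0 // ltW.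
- by move=> i; rewrite !coord_mkbelief; field; rewrite !lt0r_neq0.
Qed.

End Geometry.

Section PlanarReduction.
Context (R : realType) (r vE vZ : 'I_3 -> R) (m : belief R) (lam delta eta : R).
Hypotheses (mS : inSimplex m) (lam_ge0 : 0 <= lam) (lam_le1 : lam <= 1).
Hypotheses (delta_ge0 : 0 <= delta) (delta_le1 : delta <= 1).
Hypotheses (eta_gt0 : 0 < eta) (eta_le1 : eta <= 1).
Hypothesis vZ_ge0 : forall i, 0 <= vZ i.
Hypothesis vZ_le1 : forall i, vZ i <= 1.
Hypothesis vEZ_le1 : forall i, vE i + vZ i <= 1.
Local Notation E p := (inner p vE).
Local Notation Z p := (inner p vZ).
Hypothesis inIE : forall p, inSimplex p -> (0 <= inner p r) = (Z p + eta * E p <= 0).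
Hypothesis Em_le0 : E m <= 0.
Hypothesis eta_or_E : eta < 1 \/ forall i, vE i <= 0.
Hypothesis rejected_mass : forall p, inSimplex p -> 0 < Z p + eta * E p ->
  exists aI aJ qI qJ, feasible_split r p aI aJ qI qJ /\
    aJ = if E p <= 0 then Z p + eta * E p else Z p + E p.

Lemma Z_range p : inSimplex p -> 0 <= Z p <= 1.
Proof. by move=> pS; rewrite inner_ge0 // inner_le. Qed.

Lemma EZ_le1 p : inSimplex p -> E p + Z p <= 1.
Proof. by move=> pS; rewrite innerDv inner_le. Qed.

(** Z + eta E and Z + E are at most 0 on I and at most 1 on the simplex, so each bounds [aJ] from
    below. [rejected_mass] attains the relevant bound, hence the inequalities used are
    equalities. *)
Lemma optimal_split_case p aI aJ qI qJ : inSimplex p -> ~ inI r p ->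
  feasible_split r p aI aJ qI qJ ->
  (forall aI' aJ' qI' qJ', feasible_split r p aI' aJ' qI' qJ' -> aI' <= aI) ->
  split_case eta aI (E qI) (Z qI) (E qJ) (Z qJ) (E p) (Z p).
Proof.
move=> pS pI feas opt; have [[aI0 aJ0 aIJ] [qIS qIr] qJS pE] := feas.
have p_gt0 : 0 < Z p + eta * E p.
  by rewrite ltNge -inIE //; apply/negP => h; apply: pI.
have := rejected_mass pS p_gt0 => -[aI' [aJ' [qI' [qJ' [feas' aJ'E]]]]].
have aJle : aJ <= aJ'.
  by have [[_ _ aIJ'] _ _ _] := feas'; have := opt _ _ _ _ feas'; lra.
have EE := inner_affine vE pE; have ZE := inner_affine vZ pE.
have mixE : Z p + eta * E p =
    aI * (Z qI + eta * E qI) + aJ * (Z qJ + eta * E qJ).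
  by rewrite EE ZE; ring.
have qI_le0 : Z qI + eta * E qI <= 0 by rewrite -inIE.
have /andP[ZI0 _] := Z_range qIS; have /andP[ZJ0 ZJ1] := Z_range qJS.
have EZJ := EZ_le1 qJS.
have EI0 : E qI <= 0 by rewrite -(pmulr_rle0 _ eta_gt0); lra.
have hI := mulr_ge0_le0 aI0 qI_le0.
have aJ_gt0 : 0 < aJ.
  rewrite lt_def aJ0 andbT; apply/eqP => aJE.
  by move: p_gt0; rewrite mixE aJE mul0r; lra.
have aJ_inj x : aJ * x = aJ -> x = 1.
  by move=> h; apply: (mulfI (lt0r_neq0 aJ_gt0)); rewrite mulr1.
have ZJ_eta : Z qJ + eta * E qJ <= 1.
  have [EJ0|EJ0] := leP (E qJ) 0; first by have := mulr_ge0_le0 (ltW eta_gt0) EJ0; lra.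
  by have := ler_wpM2r (ltW EJ0) eta_le1; lra.
move: aJ'E; have [E0|E0] := leP (E p) 0 => aJ'E; [left|right].
  have hJ := ler_wpM2l aJ0 ZJ_eta.
  have hI0 : aI * (Z qI + eta * E qI) = 0 by lra.
  have hJ1 : Z qJ + eta * E qJ = 1 by apply: aJ_inj; lra.
  split => //; case: eta_or_E => [eta1|vE0]; last exact: inner_le.
  by rewrite -(pmulr_rle0 _ (_ : 0 < 1 - eta)) ?subr_gt0 //; lra.
have eta1 : 0 < 1 - eta.
  case: eta_or_E => [|vE0]; first by rewrite subr_gt0.
  by have := inner_le pS vE0; rewrite leNgt E0.
have hJ := ler_wpM2l aJ0 EZJ.
have hI' := mulr_ge0_le0 aI0 (mulr_ge0_le0 (ltW eta1) EI0).
(* [aI * (Z qI + E qI)] is the sum of two nonpositive terms, and minimality of [aJ] makes it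
   nonnegative. *)
have hE : (1 - eta) * (aI * E qI) = 0 by lra.
have hE0 : aI * E qI = 0.
  by move/eqP: hE; rewrite mulf_eq0 (gt_eqF eta1) => /eqP.
have hZ0 : aI * Z qI = 0.
  have := mulr_ge0 aI0 ZI0; have : aI * (eta * E qI) = 0 by rewrite mulrCA hE0 mulr0.
  by lra.
have hJ1 : E qJ + Z qJ = 1 by apply: aJ_inj; lra.
have EJ0 : 0 < E qJ by rewrite -(pmulr_rgt0 _ aJ_gt0); lra.
by split => //; [rewrite (ltW EJ0); lra|lra].
Qed.

Lemma indic_inI q : inSimplex q ->
  \1_[set x | inI r x] q = (if Z q + eta * E q <= 0 then 1 else 0) :> R.
Proof.
move=> qS; rewrite indicE -inIE //; case: ifPn => h; first by rewrite mem_set.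
by rewrite memNset // => -[_]; exact/negP.
Qed.

Lemma majorant_of_planar (W : nat -> R -> R -> R) n p :
  (forall e0 z0, 0 <= z0 -> exists k x y : R, k + x * e0 + y * z0 = W n.+1 e0 z0 /\
    forall e z, 0 <= z -> W n.+1 e z <= k + x * e + y * z) ->
  (forall e z, 0 <= z <= 1 -> e + z <= 1 -> (if z + eta * e <= 0 then 1 else 0 : R)
    + delta * W n (mix lam (E m) e) (mix lam (Z m) z) <= W n.+1 e z) ->
  inSimplex p ->
  exists l, inner p l = W n.+1 (E p) (Z p) /\ forall q, inSimplex q ->
    \1_[set x | inI r x] q + delta * W n (E (phi (trans lam m) q)) (Z (phi (trans lam m) q))
      <= inner q l.
Proof.
move=> majo step pS; have /andP[Z0 _] := Z_range pS.
have [k [x [y [<- le_kxy]]]] := majo (E p) _ Z0.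
(* On the simplex the constant [k] is the linear functional with all coefficients [k]. *)
exists (fun i => k + x * vE i + y * vZ i).
have innerE q : inSimplex q ->
    inner q (fun i => k + x * vE i + y * vZ i) = k + x * E q + y * Z q.
  by move=> qS; rewrite -[k in RHS](inner_cst k qS) !innerZv !innerDv.
split; first exact: innerE.
move=> q qS; rewrite indic_inI // !inner_phi // innerE //.
have Zq := Z_range qS; apply: (le_trans (step _ _ Zq (EZ_le1 qS))).
by apply: le_kxy; case/andP: Zq.
Qed.

Lemma planar_greedy_optimal g p1 : greedy_selector r g -> inSimplex p1 ->
  optimal_at r delta (trans lam m) p1 (greedy_strategy (trans lam m) p1 g).
Proof.
move=> gr p1S; have /andP[Zm0 Zm1] := Z_range mS.
have phiS q : inSimplex q -> inSimplex (phi (trans lam m) q).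
  exact: inSimplex_phi.
have [hm|hm] := leP (Z m + eta * E m) 0.
- apply: (greedy_optimal delta_ge0 delta_le1 phiS
    (W := fun n p => value_inside delta lam eta (E m) (Z m) n (E p) (Z p))) => //.
  + by move=> p; rewrite /value_inside /= subrr.
  + move=> n p pS; apply: majorant_of_planar => //.
      by move=> *; exact: value_inside_majorant.
    by move=> *; exact: value_inside_step.
  + move=> n p [pS pr]; rewrite !inner_phi //; apply: value_inside_accept => //.
    by rewrite -inIE.
  + move=> n p aI aJ qI qJ pS pI feas opt.
    have cas := optimal_split_case pS pI feas opt.
    have [[aI0 aJ0 aIJ] [qIS qIr] qJS pE] := feas.
    rewrite !inner_phi //; apply: value_inside_split => //.
    * by rewrite -inIE.
    * by rewrite ltNge -inIE //; apply/negP => h; apply: pI.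
    * exact: inner_affine.
    * exact: inner_affine.
- apply: (greedy_optimal delta_ge0 delta_le1 phiS
    (W := fun n p => value_outside delta lam eta (E m) (Z m) n (E p) (Z p))) => //.
  + by move=> p; rewrite /value_outside /= subrr.
  + move=> n p pS; apply: majorant_of_planar => //.
      by move=> *; exact: value_outside_majorant.
    by move=> *; exact: value_outside_step.
  + move=> n p [pS pr]; have /andP[Z0 _] := Z_range pS.
    rewrite !inner_phi //; apply: value_outside_accept => //.
    by rewrite -inIE.
  + move=> n p aI aJ qI qJ pS pI feas opt.
    have cas := optimal_split_case pS pI feas opt.
    have [[aI0 aJ0 aIJ] [qIS qIr] qJS pE] := feas.
    rewrite !inner_phi //; apply: value_outside_split => //.
    * exact: ltW.
    * exact: inner_affine.
    * exact: inner_affine.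
    * exact: Z_range.
    * exact: EZ_le1.
Qed.

End PlanarReduction.


(** * Planar coordinates for equal and for distinct losses *)

Section Cases.
Context (R : realType) (r : 'I_3 -> R) (m : belief R) (lam delta : R).
Hypotheses (mS : inSimplex m) (lam_ge0 : 0 <= lam) (lam_le1 : lam <= 1).
Hypotheses (delta_ge0 : 0 <= delta) (delta_le1 : delta <= 1).
Context (g : belief R -> probability (belief R) R) (p1 : belief R).
Hypotheses (gr : greedy_selector r g) (p1S : inSimplex p1).

(** Z is the total mass of the negative states and [eta = 1]. Since E <= 0 everywhere, only that
    branch of the planar analysis occurs. *)
Lemma greedy_optimal_equal_losses (A C : 'I_3) : 0 <= r A -> r C < 0 ->
  (forall i, r i < 0 -> r i = r C) ->
  optimal_at r delta (trans lam m) p1 (greedy_strategy (trans lam m) p1 g).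
Proof.
move=> rA rC rneg.
pose vZ i : R := if r i < 0 then 1 else 0.
pose vE i : R := if r i < 0 then 0 else r i / r C.
have vE_le0 i : vE i <= 0.
  rewrite /vE; case: ltP => // ri.
  by rewrite mulr_ge0_le0 // invr_le0 ltW.
have vZ_ge0 i : 0 <= vZ i by rewrite /vZ; case: ifP.
have vZ_le1 i : vZ i <= 1 by rewrite /vZ; case: ifP.
have vEZ p : inner p vZ + 1 * inner p vE = inner p r / r C.
  rewrite mul1r innerDv mulrC innerZv; apply: eq_bigr => i _; congr (_ * _).
  rewrite /vZ /vE; case: ltP => ri; last by rewrite add0r mulrC.
  by rewrite (rneg _ ri) addr0 mulVf // lt_eqF.
apply: (@planar_greedy_optimal _ _ vE vZ m lam delta 1) => //.
- by move=> i; have := vE_le0 i; have := vZ_le1 i; lra.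
- by move=> p _; rewrite vEZ nmulr_lle0 // invr_lt0.
- exact: inner_le.
- by right.
move=> p pS; rewrite vEZ (inner_le pS vE_le0); set y := inner p r / r C => y0.
have E0 := inner_le pS vE_le0.
have yZ : y <= inner p vZ by have := vEZ p; rewrite -/y; lra.
have Z0 : 0 < inner p vZ by exact: lt_le_trans yZ.
pose x i := y / inner p vZ * (coord p i * vZ i).
have sx : \sum_i x i = y by rewrite -mulr_sumr -/(inner p vZ) divfK // lt0r_neq0.
have sxr : \sum_i x i * r i = inner p r.
  transitivity (y * r C); last by rewrite /y divfK // lt_eqF.
  rewrite -[in RHS]sx mulr_suml; apply: eq_bigr => i _.
  rewrite /x /vZ; case: ltP => ri; first by rewrite (rneg _ ri).
  by rewrite !mulr0 !mul0r.
have t1 : y / inner p vZ <= 1 by rewrite ler_pdivrMr // mul1r.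
have t0 : 0 <= y / inner p vZ by rewrite divr_ge0 // ltW.
have [|||aI [qI [qJ feas]]] := @feasible_split_of_part _ r p x A pS rA.
- move=> i; have p0 := pS.1 i.
  have pv : 0 <= coord p i * vZ i by rewrite mulr_ge0.
  rewrite /x mulr_ge0 //= (@le_trans _ _ (coord p i * vZ i)) //.
    by rewrite ler_piMl.
  by rewrite ler_piMr.
- by rewrite sx.
- by rewrite sxr subrr.
by exists aI, y, qI, qJ; split => //; rewrite -sx.
Qed.

(** Z is the mass of C, and E is the mass of B in excess of what the mass of A compensates; [eta] is
    the loss at B relative to C. *)
Lemma greedy_optimal_distinct_losses (A B C : 'I_3) :
  A != B -> A != C -> B != C -> 0 <= r A -> r C < r B -> r B < 0 ->
  r A / r B * coord m A + coord m B <= 0 ->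
  optimal_at r delta (trans lam m) p1 (greedy_strategy (trans lam m) p1 g).
Proof.
move=> AB AC BC rA rCB rB0 Em.
have rC0 : r C < 0 by exact: lt_trans rB0.
pose vZ i : R := if i == C then 1 else 0.
pose vE i : R := if i == A then r A / r B else if i == B then 1 else 0.
pose eta := r B / r C.
have rAB : r A / r B <= 0 by rewrite mulr_ge0_le0 // invr_le0 ltW.
have eta_gt0 : 0 < eta by rewrite nmulr_rgt0 // invr_lt0.
have eta_lt1 : eta < 1 by rewrite ltr_ndivrMr // mul1r.
have innerE p v : inner p v = coord p A * v A + coord p B * v B + coord p C * v C.
  exact: sum_ord3.
have ZE p : inner p vZ = coord p C.
  by rewrite innerE /vZ (negbTE AC) (negbTE BC) eqxx !mulr0 !add0r mulr1.
have EE p : inner p vE = r A / r B * coord p A + coord p B.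
  rewrite innerE /vE eqxx [B == A]eq_sym (negbTE AB) eqxx [C == A]eq_sym (negbTE AC).
  by rewrite [C == B]eq_sym (negbTE BC) mulr0 addr0 mulr1 mulrC.
have rBn0 : r B != 0 by rewrite lt_eqF.
have rCn0 : r C != 0 by rewrite lt_eqF.
have vEZ p : inner p vZ + eta * inner p vE = inner p r / r C.
  by rewrite ZE EE innerE /eta; field; rewrite rBn0 rCn0.
apply: (@planar_greedy_optimal _ _ vE vZ m lam delta eta) => //.
- exact: ltW.
- by move=> i; rewrite /vZ; case: ifP.
- by move=> i; rewrite /vZ; case: ifP.
- move=> i; rewrite /vZ /vE; case: eqVneq => [->|_].
    by rewrite (negbTE AC) addr0 (le_trans rAB).
  by case: eqVneq => [->|_]; [rewrite (negbTE BC) addr0|rewrite add0r; case: ifP].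
- by move=> p _; rewrite vEZ nmulr_lle0 // invr_lt0.
- by rewrite EE.
- by left.
move=> p pS y0; have p0 := pS.1.
have pE : coord p A + coord p B + coord p C = 1.
  by rewrite -[RHS]pS.2 (sum_ord3 _ AB AC BC).
have rABp : r A / r B * coord p A <= 0 by rewrite mulr_le0_ge0.
have [E0|E0] := leP (inner p vE) 0.
(* A compensates all of B: only C is rejected, just enough to leave a remainder with zero payoff. *)
- pose x i : R := if i == C then inner p vZ + eta * inner p vE else 0.
  have xA : x A = 0 by rewrite /x (negbTE AC).
  have xB : x B = 0 by rewrite /x (negbTE BC).
  have xC : x C = inner p vZ + eta * inner p vE by rewrite /x eqxx.
  have sx : \sum_i x i = inner p vZ + eta * inner p vE.
    by rewrite (sum_ord3 _ AB AC BC) xA xB xC !add0r.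
  have [|||aI [qI [qJ feas]]] := @feasible_split_of_part _ r p x A pS rA.
  + move=> i; rewrite /x; case: eqVneq => [->|_]; last by rewrite lexx p0.
    by rewrite (ltW y0) ZE gerDl mulr_ge0_le0 // ltW.
  + by rewrite sx.
  + rewrite (sum_ord3 _ AB AC BC) xA xB xC !mul0r !add0r vEZ divfK //.
    by rewrite subrr.
  by exists aI, (inner p vZ + eta * inner p vE), qI, qJ; split => //; rewrite -sx.
(* A cannot compensate B: all of C and the excess of B are rejected. *)
- pose x i : R := if i == A then 0 else if i == B then inner p vE else coord p C.
  have xA : x A = 0 by rewrite /x eqxx.
  have xB : x B = inner p vE by rewrite /x eq_sym (negbTE AB) eqxx.
  have xC : x C = coord p C.
    by rewrite /x eq_sym (negbTE AC) eq_sym (negbTE BC).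
  have sx : \sum_i x i = inner p vZ + inner p vE.
    by rewrite (sum_ord3 _ AB AC BC) xA xB xC ZE add0r addrC.
  have [|||aI [qI [qJ feas]]] := @feasible_split_of_part _ r p x A pS rA.
  + move=> i; have := p0 i; rewrite /x; case: eqVneq => [-> ->|iA]; first by rewrite lexx.
    case: eqVneq => [->|iB] pi0; first by rewrite (ltW E0) EE gerDr.
    by rewrite (ord3_third AB AC BC iA iB) p0 lexx.
  + by rewrite sx ZE ltr_wpDl.
  + rewrite (sum_ord3 _ AB AC BC) xA xB xC EE innerE mul0r add0r.
    by rewrite le_eqVlt; apply/orP; left; apply/eqP; field.
  by exists aI, (inner p vZ + inner p vE), qI, qJ; split => //; rewrite -sx.
Qed.

End Cases.

Theorem theorem4 (R : realType) (m : belief R) (lam delta : R) (r : 'I_3 -> R)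
  (g : belief R -> probability (belief R) R) :
  inSimplex m -> 0 <= lam < 1 -> 0 <= delta < 1 ->
  irreducible (trans lam m) ->
  greedy_selector r g ->
  ( (* case (i): |Omega^-| = 1 *)
    #|[pred w : 'I_3 | r w < 0]| = 1%N
    \/
    (* case (ii): Omega^+ = {A}, Omega^- = {B, C}, r(B) >= r(C) *)
    (exists (A B C : 'I_3) (Bp Cp : belief R),
       [/\ [/\ A != B, A != C & B != C],
           [/\ 0 <= r A, r B < 0, r C < 0 & r C <= r B] &
           [/\ in_segment Bp (vertex R A) (vertex R B), inF r Bp,
               in_segment Cp (vertex R A) (vertex R C), inF r Cp &
               inI r m \/ in_triangle m Cp Bp (vertex R C)]]) ) ->
  forall p1 : belief R, inSimplex p1 ->
    optimal_at r delta (trans lam m) p1 (greedy_strategy (trans lam m) p1 g).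
Proof.
move=> mS /andP[l0 /ltW l1] /andP[d0 /ltW d1] _ gr cas p1 p1S.
case: cas => [/mem_card1[C negC]|[A [B [C [Bp [Cp [[AB AC BC]]]]]]]].
  have rneg i : (r i < 0) = (i == C) by have := negC i; rewrite !inE.
  have [A AC] : exists A : 'I_3, A != C.
    by case: (eqVneq C ord0) => [->|C0]; [exists ord_max|exists ord0; rewrite eq_sym].
  apply: (greedy_optimal_equal_losses mS l0 l1 d0 d1 gr p1S (A := A) (C := C)) => //.
  - by rewrite leNgt rneg.
  - by rewrite rneg.
  - by move=> i; rewrite rneg => /eqP ->.
move=> [rA rB rC]; rewrite le_eqVlt => rCB [_ BpF _ CpF mcase].
(* When [r B = r C] the ratio [eta] would be 1, so this subcase joins the equal losses. *)
case/orP: rCB => [/eqP rCB|rCB].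
  apply: (greedy_optimal_equal_losses mS l0 l1 d0 d1 gr p1S (A := A) (C := C)) => //.
  move=> i ri; have [iA|iA] := eqVneq i A; first by rewrite iA ltNge rA in ri.
  have [->//|iB] := eqVneq i B.
  by rewrite (ord3_third AB AC BC iA iB).
apply: (greedy_optimal_distinct_losses mS l0 l1 d0 d1 gr p1S AB AC BC) => //.
(* The functional E: it is nonpositive on I, hence at C+ and B+, and zero at C, so it is nonpositive
   on the triangle. *)
pose e (p : belief R) := r A / r B * coord p A + coord p B.
have e_le0 p : inI r p -> e p <= 0.
  move=> [pS]; rewrite /inner (sum_ord3 _ AB AC BC) => pr.
  rewrite -(nmulr_lge0 _ rB) /e mulrDl mulrAC divfK ?lt_eqF //.
  by have := mulr_ge0_le0 (pS.1 C) (ltW rC); lra.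
case: mcase => [/e_le0 //|[s [t [u [s0 t0 u0 _ mE]]]]].
have eCp : e Cp <= 0 by apply: e_le0; case: CpF => CpS Cpr; split; rewrite ?Cpr.
have eBp : e Bp <= 0 by apply: e_le0; case: BpF => BpS Bpr; split; rewrite ?Bpr.
rewrite !mE !coord_mkbelief (negbTE AC) (negbTE BC).
have := mulr_ge0_le0 s0 eCp; have := mulr_ge0_le0 t0 eBp.
by rewrite /e; lra.
Qed.
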